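(* Let $c>0$ and $c'\in\mathbb{R}$, and let $M=M_N$ be a sequence of positive integers with $\lim_{N\to\infty} M/N=c$ and $\lim_{N\to\infty}(M-cN)=c'$. Let $X_N=\frac1N GG^t$ be the $N\times N$ real Wishart matrix, with $G$ an $N\times M$ matrix of i.i.d. real $\mathcal{N}(0,1)$ entries. For $n\ge 1$ let $m_n'=\lim_{N\to\infty}N\big(\mathrm{E}(\mathrm{tr}(X_N^n))-\sum_{\pi\in NC(n)}c^{\#(\pi)}\big)$, and let $m_0'=0$. Let $a=(1-\sqrt c)^2$, $b=(1+\sqrt c)^2$ and $P(z)=(z-a)(z-b)$. Then, for complex $z$ with $|z|$ sufficiently large, $$\sum_{n=0}^\infty\frac{m_n'}{z^{n+1}}=\frac{-c'}{z\sqrt{P(z)}}\cdot\frac{(1-c)^2-(1+c)z-(1-c)\sqrt{P(z)}}{\sqrt{P(z)}+z-1+c}+\frac12\left\{\frac12\Big(\frac1{z-a}+\frac1{z-b}\Big)-\frac1{\sqrt{(z-a)(z-b)}}\right\}.$$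
   Context: $\mathrm{tr}=N^{-1}\mathrm{Tr}$ is the normalized trace. $NC(n)$ is the set of non-crossing partitions of $\{1,\dots,n\}$ and $\#(\pi)$ is the number of blocks of $\pi$. $\sqrt{P(z)}=\sqrt{(z-a)(z-b)}$ denotes the branch analytic on $\mathbb{C}\setminus[a,b]$ with $\sqrt{P(z)}/z\to1$ as $z\to\infty$. *)

(* Defs.v *)
From HB Require Import structures.
From mathcomp Require Import all_boot all_order all_algebra.
From mathcomp Require Import complex.
From mathcomp Require Import all_classical all_reals all_analysis.

Set Implicit Arguments.
Unset Strict Implicit.
Unset Printing Implicit Defensive.

Import Order.TTheory GRing.Theory Num.Theory.
Import numFieldNormedType.Exports.

Local Open Scope classical_set_scope.
Local Open Scope ring_scope.
Local Open Scope complex_scope.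

Section Probability.
Context (d : measure_display) (T : measurableType d) (R : realType).
Variable P : probability T R.

Definition mutually_independent (I : finType) (X : I -> {RV P >-> R}) : Prop :=
  forall (J : {set I}) (A : I -> set R), (forall i, measurable (A i)) ->
  P (\bigcap_(i in [set` J]) (X i @^-1` A i)) =
  (\prod_(i in J) P (X i @^-1` A i))%E.

(* [normal_prob] takes the standard deviation as second parameter; its values
   on non-measurable sets are irrelevant. *)
Definition standard_normal (X : {RV P >-> R}) : Prop :=
  forall A : set R, measurable A -> distribution P X A = normal_prob 0 1 A.

Definition iid_standard_normal (I : finType) (X : I -> {RV P >-> R}) : Prop :=
  (forall i, standard_normal (X i)) /\ mutually_independent X.

Definition wishart (N M : nat) (G : 'I_N * 'I_M -> {RV P >-> R}) (w : T) :
    'M[R]_N :=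
  let A := \matrix_(i < N, j < M) G (i, j) w in N%:R^-1 *: (A *m A^T).

End Probability.

Definition ntr (R : fieldType) (N : nat) (A : 'M[R]_N) : R := N%:R^-1 * \tr A.

(* [{1, ..., n}] is represented by ['I_n] = {0, ..., n - 1}. *)
Definition noncrossing (n : nat) (p : {set {set 'I_n}}) : bool :=
  [forall B1 in p, forall B2 in p, (B1 != B2) ==>
    ~~ [exists i in B1, exists j in B2, exists k in B1, exists l in B2,
         [&& (i < j)%N, (j < k)%N & (k < l)%N]]].

Definition NC (n : nat) : {set {set {set 'I_n}}} :=
  [set p : {set {set 'I_n}} |
    finset.partition p [set: 'I_n]%SET && noncrossing p]%SET.

Definition moment_correction (R : realType) (d : nat -> measure_display)
    (T : forall N, measurableType (d N)) (P : forall N, probability (T N) R)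
    (M : nat -> nat) (G : forall N, 'I_N * 'I_(M N) -> {RV (P N) >-> R})
    (c : R) (n N : nat) : R :=
  N%:R * (fine 'E_(P N)[fun w => ntr (wishart (G N) w ^+ n)]
          - \sum_(p in NC n) c ^+ #|p|).

Definition infinitesimal_moment (R : realType) (d : nat -> measure_display)
    (T : forall N, measurableType (d N)) (P : forall N, probability (T N) R)
    (M : nat -> nat) (G : forall N, 'I_N * 'I_(M N) -> {RV (P N) >-> R})
    (c : R) (n : nat) : R :=
  if n == 0%N then 0 else lim (moment_correction G c n @ \oo).

(* [R[i]^o] carries the usual topology of the complex numbers, seen as a
   normed module over themselves: [derivable] is complex differentiability. *)
Definition is_sqrt_branch (R : realType) (a b : R) (s : R[i]^o -> R[i]^o) :
    Prop :=
  [/\ forall z : R[i],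
        ~ (exists2 t : R, a <= t <= b & z = t%:C) -> derivable s z 1,
      forall z : R[i],
        ~ (exists2 t : R, a <= t <= b & z = t%:C) ->
        s z ^+ 2 = (z - a%:C) * (z - b%:C)
    & forall eps : R, 0 < eps -> exists K : R,
        forall z : R[i], K%:C < `|z| -> `|s z / z - 1| < eps%:C].

(* Main.v *)
Require Import Defs.
From HB Require Import structures.
From mathcomp Require Import all_boot all_order all_algebra.
From mathcomp Require Import ring lra zify.

Set Implicit Arguments.
Unset Strict Implicit.
Unset Printing Implicit Defensive.

Import Order.TTheory GRing.Theory Num.Theory.

Local Open Scope ring_scope.

(** Let [W = G G^t], [x = M / N] and [y = 1 / N], and for a list [s] of exponents
let [E(s)] be the expectation of the product of the [tr (X_N ^ l)], [l] in [s].

Writing [Tr (W ^ (n+1))] as the sum of the [g_ij (W ^ n G)_ij] and integrating by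
parts, [E (g_ij f) = E (d f / d g_ij)] for polynomial [f], gives the exact loop
equation (lemma [trace_moment_S])
  [E(n+1 :: s) = x E(n :: s) + sum_(k < n) E(k :: n-k :: s) + n y E(n :: s)]
plus [y ^ 2] times a combination of moments of lower weight.  Without its
last term the system is solved by products of the numbers [mu_l] given by
  [mu_0 = 1], [mu_(n+1) = x mu_n + sum_(k < n) mu_k mu_(n-k) + n y mu_n]
([planar_moment x y]), and induction on the weight of [s] shows that [E(s)] is
the product of the [mu_l] up to [O(1 / N ^ 2)] ([trace_moments_factorize]):
correlations between traces are a second order effect.  Hence the [1 / N]
correction to [E (tr (X_N ^ n))] is the one of [mu_n] along
[(x, y) = (c + c' / N, 1 / N)].  Linearizing the recursion in these parameters
defines [linearized_moment], and [moment_expansion_cvg] identifies it with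
[m'_n].  At [(x, y) = (c, 0)] the recursion is the one satisfied by the weighted
count of non-crossing partitions ([sum_noncrossing]): either the least point is
a singleton, or the partition is cut at the next point of its block.

With [u = 1 / z], [f], [D] and [h] the generating series of [m_n], [n m_n] and
[m'_n], and [S] the branch of the square root of [P], the recursions become
  [f = 1 + u (c f + f ^ 2 - f)], i.e. [(z + 1 - c - 2 f) ^ 2 = P(z)],
  [u S D = f - 1] (apply the Euler operator) and [S h = c' f + D],
since [z + 1 - c - 2 f = S] by comparing sizes at large [z].  Eliminating [f] and
[D] gives the closed formula ([linearized_seriesE]).  These equations are used
for partial sums, where they hold up to an error [O(2 ^ -N)]; this gives
convergence of the series and the value of its sum together. *)

(** * Loop equations for a functional obeying integration by parts *)

(** The terms produced by differentiating a product of traces in the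
direction [W ^ n g]: the trace of [W ^ l] contributes [2 l] times the trace of
[W ^ (n + l)]. *)
Fixpoint merges (n : nat) (s : seq nat) : seq (nat * seq nat) :=
  if s is l :: s' then
    (l.*2, (n + l)%N :: s') :: [seq (cs.1, l :: cs.2) | cs <- merges n s']
  else [::].

Lemma merges_size n s cs : cs \in merges n s ->
  size cs.2 = size s /\ sumn cs.2 = (n + sumn s)%N.
Proof.
elim: s cs => [//|l s IHs] cs /=; rewrite inE => /orP[/eqP -> /=|].
  by rewrite addnA.
by case/mapP => cs' /IHs[sz sm] -> /=; rewrite sz sm addnCA.
Qed.

(** The functional [L] is abstract: only the derivation rules for [D i j] and the
integration by parts formula [L_Stein] enter, so that all matrix computations
take place in a commutative ring. *)
Section LoopEquation.
Variables (A : comNzRingType) (F : fieldType) (L : {additive A -> F}) (N M : nat).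
Variables (g : 'M[A]_(N, M)) (D : 'I_N -> 'I_M -> {additive A -> A}).
Hypothesis D_Leibniz : forall i j x y, D i j (x * y) = D i j x * y + x * D i j y.
Hypothesis D_gen : forall i j, map_mx (D i j) g = delta_mx i j.
Hypothesis L_Stein : forall i j x, L (g i j * x) = L (D i j x).

Local Notation W := (g *m g^T).

Lemma D_mulmx i j p q r (B : 'M[A]_(p, q)) (C : 'M[A]_(q, r)) :
  map_mx (D i j) (B *m C) = map_mx (D i j) B *m C + B *m map_mx (D i j) C.
Proof.
apply/matrixP => k l; rewrite !mxE raddf_sum -big_split /=.
by apply: eq_bigr => s _; rewrite D_Leibniz !mxE.
Qed.

Lemma mulmx_deltaE p q r s (B : 'M[A]_(p, q)) (C : 'M[A]_(r, s)) i j k l :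
  (B *m delta_mx i j *m C) k l = B k i * C j l.
Proof.
rewrite mxE (bigD1 j) //= big1 ?addr0 => [|t /negbTE jt]; last first.
  by rewrite mxE big1 ?mul0r // => u _; rewrite mxE jt andbF mulr0.
rewrite mxE (bigD1 i) //= big1 ?addr0 => [|u /negbTE iu]; last first.
  by rewrite mxE iu mulr0.
by rewrite mxE !eqxx mulr1.
Qed.

Lemma mxtrace_delta p q (B : 'M[A]_(p, q)) i j :
  \tr (B *m delta_mx i j) = B j i.
Proof.
rewrite /mxtrace (bigD1 j) //= big1 ?addr0 => [|k /negbTE kj].
  by rewrite -[_ *m delta_mx _ _]mulmx1 mulmx_deltaE mxE eqxx mulr1.
by rewrite -[_ *m delta_mx _ _]mulmx1 mulmx_deltaE mxE eq_sym kj mulr0.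
Qed.

Lemma D_one i j : D i j 1 = 0.
Proof.
have := D_Leibniz i j 1 1; rewrite !mulr1 mul1r => /eqP.
by rewrite -subr_eq0 opprD addrA subrr add0r oppr_eq0 => /eqP.
Qed.

Lemma D_W i j :
  map_mx (D i j) W = delta_mx i j *m g^T + g *m delta_mx j i.
Proof. by rewrite D_mulmx -map_trmx D_gen trmx_delta. Qed.

Lemma D_expW i j n : map_mx (D i j) (W ^+ n) =
  \sum_(k < n) W ^+ k *m map_mx (D i j) W *m W ^+ (n.-1 - k).
Proof.
elim: n => [|n IHn].
  rewrite big_ord0; apply/matrixP => k l; rewrite !mxE.
  by case: (k == l); rewrite ?D_one ?raddf0.
rewrite exprSr -mulmxE [LHS]D_mulmx IHn big_ord_recr /= subnn expr0 mulmx1; congr (_ + _).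
rewrite mulmx_suml; apply: eq_bigr => k _.
rewrite -(mulmxA _ (W ^+ _)) (_ : (n - k)%N = (n.-1 - k).+1) ?exprSr //.
by have := ltn_ord k; lia.
Qed.

Lemma trmx_expW n : (W ^+ n)^T = W ^+ n.
Proof.
elim: n => [|n IHn]; first by rewrite expr0 trmx1.
by rewrite exprS -mulmxE trmx_mul IHn trmx_mul trmxK !mulmxE -exprSr exprS.
Qed.

(** By symmetry of [W], the sum is the trace of [W ^ k g g^t W ^ l]. *)
Lemma sum_entries_expW k l :
  \sum_i \sum_j (W ^+ k *m g) i j * (W ^+ l *m g) i j = \tr (W ^+ (k + l).+1).
Proof.
transitivity (\tr (W ^+ k *m g *m (W ^+ l *m g)^T)).
  by apply: eq_bigr => i _; rewrite mxE; apply: eq_bigr => j _; rewrite !mxE.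
rewrite trmx_mul trmx_expW mulmxA -(mulmxA _ g g^T).
by rewrite !mulmxE -exprSr -exprD addSn.
Qed.

(** Cyclicity of the trace makes the [n] terms of the Leibniz rule equal; the
factor 2 comes from the two occurrences of [g] in [W]. *)
Lemma D_trace i j n :
  D i j (\tr (W ^+ n)) = ((W ^+ n.-1 *m g) i j) *+ n *+ 2.
Proof.
have -> : D i j (\tr (W ^+ n)) = \tr (map_mx (D i j) (W ^+ n)).
  by rewrite raddf_sum; apply: eq_bigr => k _; rewrite mxE.
rewrite D_expW raddf_sum /= -[in RHS](card_ord n) -sumr_const -sumrMnl.
apply: eq_bigr => k _.
rewrite mxtrace_mulC mulmxA mulmxE -exprD subnK; last first.
  by have := ltn_ord k; lia.
rewrite D_W -mulmxE mulmxDr raddfD /= mulr2n; congr (_ + _).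
  rewrite mulmxA mxtrace_mulC mulmxA mxtrace_delta.
  by rewrite card_ord -{1}[W ^+ _]trmx_expW -trmx_mul mxE.
by rewrite card_ord mulmxA mxtrace_delta.
Qed.

(** Differentiating the outer factor [g] gives the first term.  Differentiating
the factors [g] of [W ^ n] splits the trace in two (second term); the factors
[g^t] give the last term, of lower order and specific to real matrices. *)
Lemma divergence_expW n :
  \sum_i \sum_j D i j ((W ^+ n *m g) i j) =
  \tr (W ^+ n) *+ M + \sum_(k < n) \tr (W ^+ k) * \tr (W ^+ (n - k))
  + \tr (W ^+ n) *+ n.
Proof.
have DE i j : D i j ((W ^+ n *m g) i j) = (W ^+ n) i i +
    \sum_(k < n) ((W ^+ k) i i * (g^T *m W ^+ (n.-1 - k) *m g) j j
      + (W ^+ k *m g) i j * (W ^+ (n.-1 - k) *m g) i j).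
  transitivity ((map_mx (D i j) (W ^+ n *m g)) i j); first by rewrite [RHS]mxE.
  rewrite D_mulmx mxE addrC D_gen; congr (_ + _).
    by rewrite -[_ *m delta_mx _ _]mulmx1 mulmx_deltaE mxE eqxx mulr1.
  rewrite D_expW mulmx_suml summxE; apply: eq_bigr => k _.
  rewrite D_W mulmxDr !mulmxDl [LHS]mxE; congr (_ + _).
    by rewrite !mulmxA -!(mulmxA (W ^+ k *m delta_mx i j)) mulmx_deltaE.
  by rewrite !mulmxA -!(mulmxA (W ^+ k *m g *m delta_mx j i)) mulmx_deltaE.
under eq_bigr do under eq_bigr do rewrite DE.
under eq_bigr do rewrite big_split /= sumr_const card_ord exchange_big /=.
rewrite big_split /= sumrMnl -addrA; congr (_ + _).
have -> : \tr (W ^+ n) *+ n = \sum_(k < n) \tr (W ^+ n).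
  by rewrite sumr_const card_ord.
rewrite exchange_big /= -big_split /=.
apply: eq_bigr => k _.
under eq_bigr do rewrite big_split /=.
rewrite big_split /=; congr (_ + _).
  under eq_bigr do rewrite -mulr_sumr.
  rewrite -mulr_suml; congr (_ * _).
  rewrite -[LHS]/(\tr (g^T *m W ^+ (n.-1 - k) *m g)) -mulmxA mxtrace_mulC.
  by rewrite -mulmxA mulmxE -exprSr; congr (\tr (W ^+ _));
    have := ltn_ord k; lia.
by rewrite sum_entries_expW; congr (\tr (W ^+ _)); have := ltn_ord k; lia.
Qed.

Definition trace_prod (s : seq nat) : A := \prod_(l <- s) \tr (W ^+ l).

Lemma gradient_trace_prod n s :
  \sum_i \sum_j (W ^+ n *m g) i j * D i j (trace_prod s) =
  \sum_(cs <- merges n s) trace_prod cs.2 *+ cs.1.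
Proof.
elim: s => [|l s IHs] /=.
  by rewrite /trace_prod !big_nil !big1 // => i _; rewrite big1 // => j _;
    rewrite D_one mulr0.
rewrite big_cons big_map /=.
transitivity (trace_prod ((n + l)%N :: s) *+ l.*2 + \tr (W ^+ l) *
  \sum_(cs <- merges n s) trace_prod cs.2 *+ cs.1); last first.
  congr (_ + _); rewrite mulr_sumr; apply: eq_bigr => cs _.
  by rewrite mulrnAr /trace_prod big_cons.
rewrite -IHs /trace_prod !big_cons -/(trace_prod s) -mulrnAl.
under eq_bigr do under eq_bigr do
  rewrite D_Leibniz D_trace mulrDr mulrA (mulrCA _ (\tr _)).
under eq_bigr do rewrite big_split /= -mulr_suml -mulr_sumr.
rewrite big_split /= -mulr_suml -mulr_sumr; congr (_ * _ + _).
under eq_bigr do under eq_bigr do rewrite !mulrnAr.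
under eq_bigr do rewrite !sumrMnl.
rewrite !sumrMnl -mulrnA muln2; case: l => [|l]; first by rewrite !mulr0n.
by rewrite sum_entries_expW addnS.
Qed.

Lemma loop_equation n s :
  L (\tr (W ^+ n.+1) * trace_prod s) =
  L (\tr (W ^+ n) * trace_prod s) *+ M
  + \sum_(k < n) L (\tr (W ^+ k) * \tr (W ^+ (n - k)) * trace_prod s)
  + L (\tr (W ^+ n) * trace_prod s) *+ n
  + \sum_(cs <- merges n s) L (trace_prod cs.2) *+ cs.1.
Proof.
have -> : \tr (W ^+ n.+1) = \sum_i \sum_j g i j * (W ^+ n *m g) i j.
  rewrite -[in LHS](addn0 n) -sum_entries_expW.
  by apply: eq_bigr => i _; apply: eq_bigr => j _; rewrite mulrC expr0 mul1mx.
rewrite mulr_suml raddf_sum /=.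
under eq_bigr do rewrite mulr_suml raddf_sum /=.
under eq_bigr do under eq_bigr do
  rewrite -mulrA L_Stein D_Leibniz raddfD /=.
under eq_bigr do rewrite big_split /= -!raddf_sum /= -mulr_suml.
rewrite big_split /= -!raddf_sum /= -mulr_suml gradient_trace_prod.
rewrite divergence_expW !mulrDl !mulrnAl !raddfD !raddfMn /=.
congr (_ + _ + _ + _); first by rewrite mulr_suml raddf_sum.
by rewrite raddf_sum; apply: eq_bigr => cs _; rewrite raddfMn.
Qed.

Hypotheses (L1 : L 1 = 1) (N_neq0 : N%:R != 0 :> F).

(** The scaling is the one of the product of the normalized traces of
[(W / N) ^ l]. *)
Definition trace_moment (s : seq nat) : F :=
  L (trace_prod s) / N%:R ^+ (size s + sumn s).

Lemma trace_moment_nil : trace_moment [::] = 1.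
Proof. by rewrite /trace_moment /trace_prod big_nil L1 expr0 divr1. Qed.

Lemma trace_moment_0 s : trace_moment (0%N :: s) = trace_moment s.
Proof.
rewrite /trace_moment /trace_prod big_cons expr0 mxtrace1 mulr_natl raddfMn /=.
by rewrite add0n addSn exprS -[L _ *+ N]mulr_natl -mulf_div divff // mul1r.
Qed.

(** Relative to the leading terms, the single trace term carries a factor
[1 / N] and the terms that merge two traces a factor [1 / N ^ 2]. *)
Lemma trace_moment_S n s : trace_moment (n.+1 :: s) =
  M%:R / N%:R * trace_moment (n :: s)
  + \sum_(k < n) trace_moment [:: k : nat, (n - k)%N & s]
  + n%:R / N%:R * trace_moment (n :: s)
  + N%:R ^- 2 * \sum_(cs <- merges n s) cs.1%:R * trace_moment cs.2.
Proof.
have shift (x : F) k : x / N%:R ^+ k.+1 = N%:R^-1 * (x / N%:R ^+ k).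
  by rewrite exprS invfM mulrCA.
rewrite /trace_moment {1}/trace_prod big_cons -/(trace_prod s) loop_equation.
rewrite /= !addSn addnS shift !mulrDl !mulrDr; congr (_ + _ + _ + _).
- by rewrite /trace_prod big_cons -[L _ *+ _]mulr_natl -!mulrA mulrCA.
- rewrite -shift mulr_suml; apply: eq_bigr => k _.
  rewrite /trace_prod !big_cons mulrA; congr (_ / _ ^+ _).
  by have := ltn_ord k; lia.
- by rewrite /trace_prod big_cons -[L _ *+ _]mulr_natl -!mulrA mulrCA.
rewrite !mulr_suml mulr_sumr mulr_sumr !big_seq; apply: eq_bigr => cs.
case/merges_size => -> ->; rewrite shift -[L _ *+ _]mulr_natl expr2 invfM.
by rewrite -!mulrA (mulrCA cs.1%:R) (mulrCA _ cs.1%:R) (mulrCA _ cs.1%:R).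
Qed.

End LoopEquation.

(** * Planar moments and factorization up to second order *)

(** Sequences defined from all their previous values: the list of these values is
built by structural recursion. *)
Section CourseOfValues.
Variables (R : zmodType) (a : R) (step : nat -> (nat -> R) -> R).
Hypothesis step_local : forall n u v,
  (forall k, (k <= n)%N -> u k = v k) -> step n u = step n v.

Fixpoint history n : seq R :=
  if n is n'.+1 then rcons (history n') (step n' (nth 0 (history n')))
  else [:: a].

Definition course_rec n : R := nth 0 (history n) n.

Lemma size_history n : size (history n) = n.+1.
Proof. by elim: n => //= n IHn; rewrite size_rcons IHn. Qed.

Lemma nth_history n k : (k <= n)%N -> nth 0 (history n) k = course_rec k.
Proof.
elim: n => [|n IHn]; first by rewrite leqn0 => /eqP ->.
rewrite leq_eqVlt => /orP[/eqP -> //|kn].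
by rewrite /= nth_rcons size_history kn IHn.
Qed.

Lemma course_recS n : course_rec n.+1 = step n course_rec.
Proof.
rewrite {1}/course_rec /= nth_rcons size_history ltnn eqxx.
by apply: step_local => k; exact: nth_history.
Qed.

End CourseOfValues.

Section PlanarMoments.
Variables (R : comNzRingType) (x y : R).

(** At [y = 0] this is the moment sequence of the Marchenko-Pastur law of ratio
[x]; the last term is the [1 / N] correction of real Wishart matrices. *)
Definition planar_moment : nat -> R :=
  course_rec 1 (fun n u => x * u n + \sum_(k < n) u k * u (n - k)%N
                           + n%:R * y * u n).

Lemma planar_moment0 : planar_moment 0 = 1. Proof. by []. Qed.

Lemma planar_momentS n : planar_moment n.+1 =
  x * planar_moment n + \sum_(k < n) planar_moment k * planar_moment (n - k)
  + n%:R * y * planar_moment n.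
Proof.
rewrite /planar_moment course_recS // => {}n u v uv.
rewrite !uv //; congr (_ + _ + _); apply: eq_bigr => k _.
by rewrite !uv // ?leq_subr // ltnW.
Qed.

End PlanarMoments.

Section LinearizedMoments.
Variables (R : comNzRingType) (c c' : R).
Local Notation m := (planar_moment c 0).

(** The derivative of [planar_moment (c + c' e) e] with respect to [e] at
[e = 0]. *)
Definition linearized_moment : nat -> R :=
  course_rec 0 (fun n u => c' * m n + c * u n
    + \sum_(k < n) (u k * m (n - k)%N + m k * u (n - k)%N) + n%:R * m n).

Lemma linearized_moment0 : linearized_moment 0 = 0. Proof. by []. Qed.

Lemma linearized_momentS n : linearized_moment n.+1 =
  c' * m n + c * linearized_moment n
  + \sum_(k < n) (linearized_moment k * m (n - k)%N
                  + m k * linearized_moment (n - k)%N)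
  + n%:R * m n.
Proof.
rewrite /linearized_moment course_recS // => {}n u v uv.
rewrite !uv //; congr (_ + _ + _); apply: eq_bigr => k _.
by rewrite !uv // ?leq_subr // ltnW.
Qed.

End LinearizedMoments.

Section PowerBound.
Variable R : realFieldType.
Implicit Types u v : nat -> R.

(** [u N = O(N ^ -p)]; the value at [N = 0], where the inverse is junk, is
excluded. *)
Definition power_bounded (p : nat) u :=
  exists C : R, forall N, (0 < N)%N -> `|u N| <= C * N%:R ^- p.

Lemma power_bounded_ext p u v : (forall N, (0 < N)%N -> u N = v N) ->
  power_bounded p u -> power_bounded p v.
Proof. by move=> uv [C hC]; exists C => N N0; rewrite -uv // hC. Qed.

Lemma power_boundedD p u v : power_bounded p u -> power_bounded p v ->
  power_bounded p (fun N => u N + v N).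
Proof.
move=> [C hC] [C' hC']; exists (C + C') => N N0.
by rewrite mulrDl (le_trans (ler_normD _ _)) // lerD ?hC ?hC'.
Qed.

Lemma power_boundedM p q u v : power_bounded p u -> power_bounded q v ->
  power_bounded (p + q) (fun N => u N * v N).
Proof.
move=> [C hC] [C' hC']; exists (C * C') => N N0.
by rewrite exprD invfM mulrACA normrM ler_pM ?hC ?hC'.
Qed.

Lemma power_bounded_cst a : power_bounded 0 (fun=> a).
Proof. by exists `|a| => N _; rewrite expr0 invr1 mulr1. Qed.

Lemma power_bounded_inv p : power_bounded p (fun N => N%:R ^- p).
Proof.
by exists 1 => N _; rewrite mul1r ger0_norm // invr_ge0 exprn_ge0.
Qed.

Lemma power_boundedW p q u : (q <= p)%N ->
  power_bounded p u -> power_bounded q u.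
Proof.
move=> qp [C hC]; exists C => N N0; apply: le_trans (hC N N0) _.
have C0 : 0 <= C.
  have := le_trans (normr_ge0 _) (hC 1%N isT).
  by rewrite expr1n invr1 mulr1.
rewrite ler_wpM2l // lef_pV2 ?posrE ?exprn_gt0 ?ltr0n //.
by rewrite ler_weXn2l // ler1n.
Qed.

Lemma power_bounded_sum (I : eqType) (r : seq I) p (u : I -> nat -> R) :
  (forall i, i \in r -> power_bounded p (u i)) ->
  power_bounded p (fun N => \sum_(i <- r) u i N).
Proof.
elim: r => [|i r IHr] ur.
  by exists 0 => N _; rewrite big_nil normr0 mul0r.
apply: (@power_bounded_ext _ (fun N => u i N + \sum_(j <- r) u j N)).
  by move=> N _; rewrite big_cons.
apply: power_boundedD; first by apply: ur; rewrite mem_head.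
by apply: IHr => j jr; apply: ur; rewrite inE jr orbT.
Qed.

End PowerBound.

Section Factorization.
Variables (R : realFieldType) (x : nat -> R) (E : nat -> seq nat -> R).
Hypothesis x_bounded : power_bounded 0 x.
Hypothesis E_nil : forall N, (0 < N)%N -> E N [::] = 1.
Hypothesis E_0 : forall N s, (0 < N)%N -> E N (0%N :: s) = E N s.
Hypothesis E_S : forall N n s, (0 < N)%N -> E N (n.+1 :: s) =
  x N * E N (n :: s)
  + \sum_(k < n) E N [:: k : nat, (n - k)%N & s]
  + n%:R / N%:R * E N (n :: s)
  + N%:R ^- 2 * \sum_(cs <- merges n s) cs.1%:R * E N cs.2.

Local Notation mu N := (planar_moment (x N) N%:R^-1).

Lemma planar_moment_bounded n : power_bounded 0 (fun N => mu N n).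
Proof.
elim/ltn_ind: n => -[_|n IHn].
  exact: (power_bounded_ext _ (power_bounded_cst 1)).
apply: (power_bounded_ext (fun N _ => esym (planar_momentS _ _ n))).
apply: power_boundedD; first apply: power_boundedD.
- exact: (power_boundedM (q := 0)) x_bounded (IHn _ _).
- apply: power_bounded_sum => k _.
  by apply: (power_boundedM (p := 0) (q := 0)); apply: IHn;
    have := ltn_ord k; lia.
- apply: (power_boundedM (p := 0) (q := 0)); last exact: IHn.
  apply: (power_boundedM (p := 0) (q := 0)); first exact: power_bounded_cst.
  exact: (@power_boundedW _ 1) (power_bounded_inv _ 1).
Qed.

Lemma planar_prod_bounded s :
  power_bounded 0 (fun N => \prod_(l <- s) mu N l).
Proof.
elim: s => [|l s IHs].
  apply: power_bounded_ext (power_bounded_cst 1) => N _.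
  by rewrite big_nil.
apply: (@power_bounded_ext _ _ (fun N => mu N l * \prod_(j <- s) mu N j)).
  by move=> N _; rewrite big_cons.
by apply: (power_boundedM (p := 0) (q := 0)) IHs; exact: planar_moment_bounded.
Qed.

(** Induction on [2 * sumn s + size s]: the lists
[[:: k, n - k & s]] have one factor more than [n.+1 :: s], but a total exponent
that is smaller by one.
All moments in the [N ^ -2] term are bounded by the induction hypothesis. *)
Lemma trace_moments_factorize s :
  power_bounded 2 (fun N => E N s - \prod_(l <- s) mu N l).
Proof.
have [w] := ubnP (2 * sumn s + size s); elim: w s => // w IHw s; rewrite ltnS.
have bd s' : (2 * sumn s' + size s' < w)%N -> power_bounded 0 (E^~ s').
  move=> /IHw h; apply: (@power_bounded_ext _ _ (fun N =>
    (E N s' - \prod_(l <- s') mu N l) + \prod_(l <- s') mu N l)).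
    by move=> N _; rewrite subrK.
  by apply: power_boundedD (planar_prod_bounded _); exact: power_boundedW h.
case: s => [|[|n] s] /= hs.
- exists 0 => N N0; rewrite big_nil E_nil // subrr normr0 mul0r //.
- apply: (@power_bounded_ext _ _ (fun N => E N s - \prod_(l <- s) mu N l)).
    by move=> N N0; rewrite big_cons planar_moment0 mul1r E_0.
  by apply: IHw; lia.
pose d s' N := E N s' - \prod_(l <- s') mu N l.
apply: (@power_bounded_ext _ _ (fun N => x N * d (n :: s) N
  + \sum_(k < n) d [:: k : nat, (n - k)%N & s] N
  + n%:R * N%:R^-1 * d (n :: s) N
  + N%:R ^- 2 * \sum_(cs <- merges n s) cs.1%:R * E N cs.2)).
  move=> N N0; rewrite E_S // big_cons planar_momentS /d sumrB !big_cons.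
  have -> : \sum_(k < n) \prod_(l <- [:: k : nat, (n - k)%N & s]) mu N l =
      (\sum_(k < n) mu N k * mu N (n - k)%N) * \prod_(l <- s) mu N l.
    by rewrite mulr_suml; apply: eq_bigr => k _; rewrite !big_cons mulrA.
  by ring.
have dn : power_bounded 2 (d (n :: s)) by apply: IHw => /=; lia.
do 3?apply: power_boundedD.
- exact: (power_boundedM (p := 0)) x_bounded dn.
- apply: power_bounded_sum => k _; apply: IHw => /=.
  by have := ltn_ord k; lia.
- apply: (power_boundedM (p := 0) (q := 2)) dn.
  apply: (power_boundedM (p := 0) (q := 0)); first exact: power_bounded_cst.
  exact: (@power_boundedW _ 1) (power_bounded_inv _ 1).
apply: (power_boundedM (p := 2) (q := 0)); first exact: power_bounded_inv.
apply: power_bounded_sum => cs /merges_size[sz sm].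
apply: (power_boundedM (p := 0) (q := 0)); first exact: power_bounded_cst.
by apply: bd; rewrite sz sm; lia.
Qed.

End Factorization.

(** * Recursion for weighted non-crossing partitions *)

(** Linear arithmetic from the order hypotheses alone, leaving the set-theoretic
ones aside. *)
Ltac order_lia := repeat match goal with
  | H : is_true (leq _ _) |- _ => revert H
  | H : is_true (leq _ _ && leq _ _) |- _ => revert H
  | H : @eq nat _ _ |- _ => revert H
  end; clear; lia.

Section NoncrossingRecursion.
Local Open Scope set_scope.
Local Open Scope nat_scope.
Variable n : nat.
Implicit Types (p q : {set {set 'I_n}}) (A B : {set 'I_n}) (i e : nat).

(** An elementwise description, which makes cutting and gluing of partitions
plain case analysis. *)
Lemma partition_spec p A : partition p A <->
  [/\ forall B, B \in p -> B \subset A, set0 \notin p,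
      forall k, k \in A -> exists2 B, B \in p & k \in B
    & forall B1 B2 k, B1 \in p -> B2 \in p -> k \in B1 -> k \in B2 -> B1 = B2].
Proof.
split=> [/and3P[/eqP <- /trivIsetP ti s0]|[sub s0 cov uni]].
  split=> // [B Bp|k /bigcupP[B Bp kB]|B1 B2 k B1p B2p k1 k2].
  - exact: (bigcup_sup B Bp).
  - by exists B.
  - apply/eqP/negPn/negP => /(ti _ _ B1p B2p)/disjoint_setI0/setP/(_ k).
    by rewrite !inE k1 k2.
apply/and3P; split=> //.
  rewrite eqEsubset; apply/andP; split; first by apply/bigcupsP.
  by apply/subsetP => k /cov[B Bp kB]; apply/bigcupP; exists B.
apply/trivIsetP => B1 B2 B1p B2p; apply: contraR.
by case/pred0Pn => k /andP[/= k1 k2]; apply/eqP; exact: (uni _ _ k).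
Qed.

Lemma noncrossing_spec p : noncrossing p <->
  forall B1 B2, B1 \in p -> B2 \in p -> B1 != B2 ->
  forall a b c d, a \in B1 -> b \in B2 -> c \in B1 -> d \in B2 ->
  (a < b)%N -> (b < c)%N -> (c < d)%N -> False.
Proof.
split=> [h B1 B2 B1p B2p ne a b c d aB bB cB dB ab bc cd|h].
  move: h => /'forall_implyP/(_ B1 B1p)/'forall_implyP/(_ B2 B2p).
  rewrite ne /= => /negP; apply.
  apply/'exists_andP; exists a; split => //.
  apply/'exists_andP; exists b; split => //.
  apply/'exists_andP; exists c; split => //.
  by apply/'exists_andP; exists d; split => //; rewrite ab bc cd.
apply/'forall_implyP => B1 B1p; apply/'forall_implyP => B2 B2p.
apply/implyP => ne; apply/negP.
case/'exists_andP => a [aB] /'exists_andP[b [bB]] /'exists_andP[c [cB]].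
case/'exists_andP => d [dB] /and3P[].
exact: h B1p B2p ne _ _ _ _ aB bB cB dB.
Qed.

Definition segment i e : {set 'I_n} := [set k : 'I_n | i <= k < e].

Definition nc_partition A p := partition p A && noncrossing p.

Variables (x : 'I_n) (e : nat).
Hypothesis x_lt_e : (x < e)%N.

Let rest := segment x.+1 e.
Let all := segment x e.

(** [j] follows the least point [x] of the segment within its block. *)
Definition next_in_block p (j : 'I_n) := (x < j)%N &&
  [exists B in p, [&& x \in B, j \in B &
     [forall k : 'I_n, (x < k < j)%N ==> (k \notin B)]]].

Definition next_elt p : 'I_n := odflt x [pick j | next_in_block p j].

(** A partition of the points strictly between [x] and [j] and a partition of the
points from [j] on are put together, [x] joining the block of [j]. *)
Definition glue (t : 'I_n * ({set {set 'I_n}} * {set {set 'I_n}})) :=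
  t.2.1 :|: [set (if t.1 \in B then x |: B else B) | B : {set 'I_n} in t.2.2].

(** The inverse of [glue]: blocks that lie strictly between [x] and its successor
[j] are separated from the others, and [x] is removed. *)
Definition cut p : 'I_n * ({set {set 'I_n}} * {set {set 'I_n}}) :=
  let inner := segment x.+1 (next_elt p) in
  (next_elt p, ([set B in p | B \subset inner],
                [set B :\ x | B : {set 'I_n} in p & ~~ (B \subset inner)])).

Definition cut_valid (t : 'I_n * ({set {set 'I_n}} * {set {set 'I_n}})) :=
  [&& (x < t.1 < e)%N, nc_partition (segment x.+1 t.1) t.2.1
    & nc_partition (segment t.1 e) t.2.2].

Lemma next_in_block_unique p j k : partition p all ->
  next_in_block p j -> next_in_block p k -> j = k.
Proof.
move=> /partition_spec[_ _ _ uni].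
case/andP=> xj /'exists_andP[B [Bp /and3P[xB jB /forallP hB]]].
case/andP=> xk /'exists_andP[C [Cp /and3P[xC kC /forallP hC]]].
have BC := uni _ _ _ Bp Cp xB xC; subst C; apply: val_inj => /=.
case: (ltngtP j k) => // jk.
  by have := hC j; rewrite xj jk jB.
by have := hB k; rewrite xk jk kC.
Qed.

Lemma next_elt_def p j : partition p all ->
  next_in_block p j -> next_elt p = j.
Proof.
rewrite /next_elt => pp pj; case: pickP => [k pk|/(_ j)]; last by rewrite pj.
exact: next_in_block_unique pp pk pj.
Qed.

Lemma next_in_block_exists p : partition p all -> [set x] \notin p ->
  exists j, next_in_block p j.
Proof.
move=> /partition_spec[sub s0 cov _] xp.
have [B Bp xB] : exists2 B, B \in p & x \in B.
  by apply: cov; rewrite inE leqnn x_lt_e.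
have [k kB] : exists k, k \in B :\ x.
  apply/set0Pn; apply: contraNneq xp => /eqP; rewrite setD_eq0 => Bx.
  suff -> : [set x] = B by [].
  by apply/eqP; rewrite eqEsubset sub1set xB Bx.
case: (@arg_minnP _ k (fun k => k \in B :\ x) (fun k => k : nat) kB) => j /=.
rewrite !inE => /andP[jx jB] jmin; exists j.
have xj k' : k' \in B -> k' != x -> (x < k')%N.
  move=> kB' kx'; have := subsetP (sub B Bp) _ kB'.
  rewrite inE => /andP[+ _]; rewrite leq_eqVlt => /orP[/eqP/val_inj xk|//].
  by rewrite xk eqxx in kx'.
rewrite /next_in_block xj //=; apply/'exists_andP; exists B; split => //.
rewrite xB jB /=; apply/forallP => l; apply/implyP => /andP[xl lj].
apply/negP => lB; have := jmin l; rewrite !inE lB.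
have -> : l != x by apply: contraTneq xl => ->; rewrite ltnn.
by move=> /(_ isT); rewrite leqNgt lj.
Qed.

(** Non-crossing forces a block that meets the open interval between [x] and [j]
to stay in it, because [x] and [j] lie in one block. *)
Lemma cut_spec p : nc_partition all p -> [set x] \notin p ->
  cut_valid (cut p) /\ glue (cut p) = p.
Proof.
case/andP => pp ncp xp.
have [j pj] := next_in_block_exists pp xp.
rewrite /cut (next_elt_def pp pj).
move/partition_spec: (pp) => [sub s0 cov uni].
move/noncrossing_spec: (ncp) => nc.
have {pj}/andP[xj /'exists_andP[X [Xp /and3P[xX jX /forallP Xno]]]] := pj.
have ltx (B : {set 'I_n}) k : B \in p -> k \in B -> (x <= k < e)%N.
  by move=> Bp kB; have := subsetP (sub B Bp) _ kB; rewrite inE.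
have je : (j < e)%N by have /andP[] := ltx X j Xp jX.
pose inner := segment x.+1 j.
(* A point of [B] beyond [j] would make [B] cross the block of [x] and [j]. *)
have innerP B k : B \in p -> k \in B -> k \in inner -> B \subset inner.
  move=> Bp kB; rewrite inE => /andP[xk kj].
  have BX : X != B.
    by apply/eqP => XB; have := Xno k; rewrite xk kj XB kB.
  apply/subsetP => l lB; rewrite inE.
  have lx : (x < l)%N.
    have /andP[+ _] := ltx _ _ Bp lB; rewrite leq_eqVlt => /orP[/eqP xl|//].
    have lx : x = l by apply: val_inj.
    by case/eqP: BX; apply: (uni _ _ x) => //; rewrite lx.
  rewrite lx /= ltnNge; apply/negP => jl.
  have {}jl : (j < l)%N.
    rewrite ltn_neqAle jl andbT; apply/negP => /eqP/val_inj jl'.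
    by case/eqP: BX; apply: (uni _ _ j) => //; rewrite jl'.
  exact: nc X B Xp Bp BX x k j l xX kB jX lB xk kj jl.
have outer B : B \in p -> ~~ (B \subset inner) -> B :\ x \subset segment j e.
  move=> Bp Bi; apply/subsetP => k /setD1P[kx kB]; rewrite inE.
  have /andP[xk ke] := ltx _ _ Bp kB; rewrite ke andbT leqNgt.
  apply: contra Bi => kj; apply: (innerP _ k) => //; rewrite inE kj andbT.
  by rewrite ltn_neqAle xk andbT; apply: contra kx => /eqP/val_inj ->.
have D1id B : x \notin B -> B :\ x = B.
  move=> xB; apply/setP => k; rewrite !inE.
  by case: eqP => // ->; rewrite (negbTE xB).
have xXB B : B \in p -> x \in B -> B = X by move=> Bp xB; apply: (uni _ _ x).
split.
- apply/and3P; split; rewrite /= ?xj //; apply/andP; split.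
  + apply/partition_spec; split.
    * by move=> B; rewrite inE => /andP[].
    * by rewrite inE (negbTE s0).
    * move=> k kin; have [B Bp kB] : exists2 B, B \in p & k \in B.
        by apply: cov; move: kin; rewrite !inE => /andP[? ?]; apply/andP; order_lia.
      by exists B => //; rewrite inE Bp (innerP _ k).
    * move=> B1 B2 k; rewrite !inE => /andP[B1p _] /andP[B2p _].
      exact: uni.
  + apply/noncrossing_spec => B1 B2; rewrite !inE => /andP[B1p _] /andP[B2p _].
    exact: nc.
  + apply/partition_spec; split.
    * by move=> _ /imsetP[B /[!inE] /andP[Bp Bi] ->]; exact: outer.
    * apply/negP => /imsetP[B /[!inE] /andP[Bp Bi]] /esym/eqP.
      rewrite setD_eq0 subset1 => /orP[]/eqP Bx.
        by rewrite -Bx Bp in xp.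
      by rewrite -Bx Bp in s0.
    * move=> k /[!inE] /andP[jk ke].
      have [B Bp kB] : exists2 B, B \in p & k \in B.
        by apply: cov; rewrite !inE; apply/andP; order_lia.
      exists (B :\ x).
        apply/imsetP; exists B => //; rewrite inE Bp /=.
        by apply/negP => /subsetP/(_ k kB); rewrite inE; order_lia.
      by rewrite !inE kB andbT; apply/eqP => kx; rewrite kx in jk; order_lia.
    * move=> C1 C2 k /imsetP[B1 /[!inE] /andP[B1p _] ->] {C1}.
      move=> /imsetP[B2 /[!inE] /andP[B2p _] ->] {C2}.
      rewrite !inE => /andP[_ k1] /andP[_ k2].
      by rewrite (uni _ _ k B1p B2p k1 k2).
  + apply/noncrossing_spec.
    move=> C1 C2 /imsetP[B1 /[!inE] /andP[B1p _] ->] {C1}.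
    move=> /imsetP[B2 /[!inE] /andP[B2p _] ->] {C2} ne a b c d.
    rewrite !inE => /andP[_ a1] /andP[_ b2] /andP[_ c1] /andP[_ d2].
    by apply: (nc B1 B2) => //; apply: contraNneq ne => ->.
- rewrite /glue /= -imset_comp; apply/setP => B; apply/setUP/idP.
    case=> [/[!inE] /andP[]//|/imsetP[C /[!inE] /andP[Cp Ci] -> /=]].
    case: ifP => [/setD1P[_ jC]|jC].
      by rewrite setD1K // (uni _ _ j Cp Xp jC jX).
    rewrite D1id //; apply/negP => xC; move: jC.
    rewrite (xXB C Cp xC) !inE jX andbT.
    by move=> /negbFE/eqP jx; rewrite jx ltnn in xj.
move=> Bp; have [Bi|Bi] := boolP (B \subset inner); [left|right].
  by rewrite inE Bp.
apply/imsetP; exists B; first by rewrite inE Bp.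
rewrite /= !inE; have jx : j != x by apply: contraTneq xj => ->; rewrite ltnn.
rewrite jx /=; case: ifP => [jB|jB].
  by rewrite setD1K // (uni _ _ j Bp Xp jB jX).
by rewrite D1id //; apply/negP => xB; rewrite (xXB B Bp xB) jX in jB.
Qed.

(** A crossing that uses [x] can be moved to one that uses [j] instead, so gluing
creates no crossing. *)
Lemma glue_spec t : cut_valid t ->
  [/\ nc_partition all (glue t), [set x] \notin glue t, cut (glue t) = t
    & #|glue t| = #|t.2.1| + #|t.2.2|].
Proof.
case: t => j [p1 p2] /and3P[/= /andP[xj je]].
case/andP => /partition_spec[sub1 s01 cov1 uni1] /noncrossing_spec nc1.
case/andP => /partition_spec[sub2 s02 cov2 uni2] /noncrossing_spec nc2.
pose ext B := if j \in B then x |: B else B.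
have gE : glue (j, (p1, p2)) = p1 :|: [set ext B | B in p2] by [].
have lt1 B k : B \in p1 -> k \in B -> x < k < j.
  by move=> Bp kB; have := subsetP (sub1 B Bp) _ kB; rewrite inE.
have lt2 B k : B \in p2 -> k \in B -> j <= k < e.
  by move=> Bp kB; have := subsetP (sub2 B Bp) _ kB; rewrite inE.
have xN2 B : B \in p2 -> x \notin B.
  by move=> Bp; apply/negP => /(lt2 _ _ Bp); order_lia.
have extE B k : (k \in ext B) = (k \in B) || (k == x) && (j \in B).
  by rewrite /ext; case: ifP => jB; rewrite ?inE ?andbT ?andbF ?orbF // orbC.
have sub_ext B : B \subset ext B by apply/subsetP => k kB; rewrite extE kB.
have ltext B k : B \in p2 -> k \in ext B -> k = x \/ j <= k < e.
  move=> Bp; rewrite extE => /orP[/(lt2 _ _ Bp)|/andP[/eqP -> _]]; first by right.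
  by left.
have ext_uni B1 B2 k : B1 \in p2 -> B2 \in p2 ->
    k \in ext B1 -> k \in ext B2 -> B1 = B2.
  move=> B1p B2p; rewrite !extE.
  have [->|/= kx] := eqVneq k x.
    rewrite (negbTE (xN2 _ B1p)) (negbTE (xN2 _ B2p)) /=; exact: uni2.
  by rewrite !orbF; exact: uni2.
have extK B : B \in p2 -> ext B :\ x = B.
  move=> Bp; apply/setP => k; rewrite !inE extE.
  by case: eqP => [->|_] /=; rewrite ?orbF // (negbTE (xN2 _ Bp)).
have nonempty2 B : B \in p2 -> exists k, k \in B.
  by move=> Bp; apply/set0Pn; apply: contraNneq s02 => <-.
have gP : partition (glue (j, (p1, p2))) all.
  rewrite gE; apply/partition_spec; split.
  - move=> B /setUP[Bp|/imsetP[C Cp ->]]; apply/subsetP => k.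
      by move=> /(lt1 _ _ Bp); rewrite inE; order_lia.
    by move=> /(ltext _ _ Cp)[->|]; rewrite inE; order_lia.
  - rewrite inE (negbTE s01) /=; apply/imsetP => -[B Bp] e0.
    by have [k kB] := nonempty2 B Bp; have := subsetP (sub_ext B) k kB;
      rewrite -e0 inE.
  - move=> k; rewrite inE => /andP[xk ke].
    have [->|kx] := eqVneq k x.
      have [B Bp jB] : exists2 B, B \in p2 & j \in B.
        by apply: cov2; rewrite inE leqnn.
      exists (ext B); first by apply/setUP; right; apply: imset_f.
      by rewrite extE eqxx jB orbT.
    have {}xk : x < k.
      by rewrite ltn_neqAle xk andbT; apply: contra kx => /eqP/val_inj ->.
    have [kj|jk] := ltnP k j.
      have [B Bp kB] : exists2 B, B \in p1 & k \in B.
        by apply: cov1; rewrite inE xk.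
      by exists B => //; rewrite inE Bp.
    have [B Bp kB] : exists2 B, B \in p2 & k \in B.
      by apply: cov2; rewrite inE jk.
    by exists (ext B); [apply/setUP; right; apply: imset_f|rewrite extE kB].
  - move=> B1 B2 k /setUP[B1p|/imsetP[C1 C1p ->]] /setUP[B2p|/imsetP[C2 C2p ->]].
    + exact: uni1.
    + by move=> /(lt1 _ _ B1p) h1 /(ltext _ _ C2p)[kx|h2];
        [rewrite kx in h1|]; order_lia.
    + by move=> /(ltext _ _ C1p) h2 /(lt1 _ _ B2p) h1;
        case: h2 => [kx|h2]; [rewrite kx in h1|]; order_lia.
    + by move=> k1 k2; rewrite (ext_uni C1 C2 k).
have gj : next_in_block (glue (j, (p1, p2))) j.
  rewrite /next_in_block xj; apply/'exists_andP.
  have [B Bp jB] : exists2 B, B \in p2 & j \in B.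
    by apply: cov2; rewrite inE leqnn.
  exists (ext B); split; first by apply/setUP; right; apply: imset_f.
  rewrite !extE jB eqxx orbT /=; apply/forallP => k; apply/implyP => /andP[xk kj].
  by apply/negP => /(ltext _ _ Bp)[kx|]; [rewrite kx ltnn in xk|order_lia].
split.
- rewrite /nc_partition gP gE; apply/noncrossing_spec => B1 B2.
  move=> /setUP[B1p|/imsetP[C1 C1p ->]] /setUP[B2p|/imsetP[C2 C2p ->]].
  + exact: nc1.
  + move=> _ a b c d /(lt1 _ _ B1p) ha /(ltext _ _ C2p) hb /(lt1 _ _ B1p) hc _.
    by case: hb => [->|]; order_lia.
  + move=> _ a b c d _ /(lt1 _ _ B2p) hb /(ltext _ _ C1p) hc /(lt1 _ _ B2p) hd.
    by case: hc => [->|]; order_lia.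
  + move=> ne; have {}ne : C1 != C2 by apply: contraNneq ne => ->.
    move=> a b c d; rewrite !extE => ha hb hc hd ab bc cd.
    have notx (k l : 'I_n) C : C \in p2 -> k < l ->
        (k \in C) || (k == x) && (j \in C) -> l != x.
      move=> Cp kl; apply: contraTneq => lx.
      rewrite negb_or negb_and; subst l; apply/andP; split.
        by apply/negP => /(lt2 _ _ Cp); order_lia.
      by rewrite (_ : k != x) //; apply: contraTneq kl => ->; rewrite ltnn.
    have bx := notx _ _ _ C1p ab ha.
    have cx := notx _ _ _ C2p bc hb.
    have dx := notx _ _ _ C1p cd hc.
    move: hb hc hd; rewrite (negbTE bx) (negbTE cx) (negbTE dx) !orbF => hb hc hd.
    (* A crossing that starts at [x] persists when [x] is replaced by [j]. *)
    case/orP: ha => [ha|/andP[_ ja]].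
      exact: (nc2 C1 C2 C1p C2p ne a b c d).
    have jb : j < b.
      have /andP[+ _] := lt2 _ _ C2p hb.
      rewrite leq_eqVlt => /orP[/eqP/val_inj jb|//].
      by case/eqP: ne; apply: (uni2 _ _ j) => //; rewrite jb.
    exact: (nc2 C1 C2 C1p C2p ne j b c d).
- rewrite gE inE negb_or; apply/andP; split.
    by apply/negP => /lt1/(_ (set11 x)); order_lia.
  apply/imsetP => -[B Bp] e1; have [k kB] := nonempty2 B Bp.
  have := subsetP (sub_ext B) k kB; rewrite -e1 inE => /eqP kx.
  by move: (xN2 B Bp); rewrite -kx kB.
- rewrite /cut (next_elt_def gP gj) gE; congr (_, (_, _)); apply/setP => B.
    rewrite !inE; have [Bp|Bp] := boolP (B \in p1) => /=.
      by apply/subsetP => k /(lt1 _ _ Bp); rewrite inE.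
    apply/negP => /andP[/imsetP[C Cp ->]] /subsetP sC.
    have [k kC] := nonempty2 C Cp.
    have := sC k (subsetP (sub_ext C) k kC); rewrite inE.
    by have := lt2 _ _ Cp kC; order_lia.
  apply/imsetP/idP => [[C]|Bp].
    rewrite !inE => /andP[/orP[Cp|/imsetP[C' C'p ->] _ ->]].
      by case/negP; apply/subsetP => k /(lt1 _ _ Cp); rewrite inE.
    by rewrite extK.
  exists (ext B); rewrite ?extK // !inE imset_f // orbT /=.
  apply/negP => /subsetP sB; have [k kB] := nonempty2 B Bp.
  have := sB k (subsetP (sub_ext B) k kB); rewrite inE.
  by have := lt2 _ _ Bp kB; order_lia.
- rewrite gE cardsU card_in_imset => [|B1 B2 B1p B2p e12]; last first.
    by rewrite -(extK _ B1p) e12 extK.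
  rewrite (_ : p1 :&: _ = set0) ?cards0 ?subn0 //.
  apply/setP => B; rewrite !inE; apply/negP => /andP[Bp /imsetP[C Cp eB]].
  have [k kC] := nonempty2 C Cp; have kB : k \in B.
    by rewrite eB; exact: subsetP (sub_ext C) k kC.
  by have := lt1 _ _ Bp kB; have := lt2 _ _ Cp kC; order_lia.
Qed.

Variables (R : comNzRingType) (c : R).

Definition nc_weight A : R := (\sum_(p | nc_partition A p) c ^+ #|p|)%R.

(** Removing the block of [x] is a bijection onto the partitions of the remaining
points. *)
Lemma nc_weight_singleton :
  (\sum_(p | nc_partition all p && ([set x] \in p)) c ^+ #|p| =
   c * nc_weight rest)%R.
Proof.
rewrite (reindex_onto (fun q => [set x] |: q) (fun p => p :\ [set x])) /=;
  last by move=> p /andP[_ xp]; rewrite setD1K.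
have Q q : (nc_partition all ([set x] |: q) && ([set x] \in [set x] |: q)
    && (([set x] |: q) :\ [set x] == q)) = nc_partition rest q.
  apply/idP/idP.
    case/andP=> /andP[/andP[/partition_spec[sub s0 cov uni] /noncrossing_spec nc] _].
    move=> /eqP qE; have xq : [set x] \notin q by rewrite -qE !inE eqxx.
    have qp B : B \in q -> B \in [set x] |: q by move=> Bq; rewrite inE Bq orbT.
    have xB B : B \in q -> x \notin B.
      move=> Bq; apply: contra xq => xB.
      by rewrite -(uni B [set x] x) ?set11 ?inE ?eqxx ?Bq ?orbT.
    apply/andP; split; last first.
      by apply/noncrossing_spec => B1 B2 /qp B1p /qp B2p; exact: nc.
    apply/partition_spec; split.
    - move=> B Bq; apply/subsetP => k kB; rewrite inE.
      have := subsetP (sub B (qp B Bq)) k kB; rewrite inE => /andP[xk ->].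
      rewrite andbT ltn_neqAle xk andbT; apply: contra (xB _ Bq).
      by move=> /eqP/val_inj ->.
    - by apply: contra s0 => /qp.
    - move=> k; rewrite inE => /andP[xk ke].
      have [B + kB] : exists2 B, B \in [set x] |: q & k \in B.
        by apply: cov; rewrite inE ltnW.
      rewrite !inE => /orP[/eqP Bx|]; last by exists B.
      by move: kB; rewrite Bx inE => /eqP kx; rewrite kx ltnn in xk.
    - by move=> B1 B2 k /qp B1p /qp B2p; exact: uni.
  case/andP=> /partition_spec[sub s0 cov uni] /noncrossing_spec nc.
  have xB B k : B \in q -> k \in B -> x < k.
    by move=> Bq kB; have := subsetP (sub B Bq) k kB; rewrite inE => /andP[].
  have xq : [set x] \notin q.
    by apply/negP => /xB/(_ (set11 x)); rewrite ltnn.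
  rewrite setU1K // eqxx andbT setU11 andbT; apply/andP; split.
    apply/partition_spec; split.
    - move=> B /setU1P[->|Bq]; apply/subsetP => k.
        by rewrite !inE => /eqP ->; rewrite leqnn.
      by move=> /(subsetP (sub B Bq)); rewrite !inE; order_lia.
    - rewrite in_setU1 negb_or s0 andbT; apply/eqP => /setP/(_ x).
      by rewrite !inE eqxx.
    - move=> k; rewrite inE => /andP[xk ke].
      have [->|kx] := eqVneq k x.
        by exists [set x]; rewrite ?set11 ?setU11.
      have [B Bq kB] : exists2 B, B \in q & k \in B.
        apply: cov; rewrite inE ke andbT ltn_neqAle xk andbT.
        by apply: contra kx => /eqP/val_inj ->.
      by exists B => //; rewrite inE Bq orbT.
    - move=> B1 B2 k /setU1P[->|B1q] /setU1P[->|B2q] //.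
      + by move=> /set1P -> /(xB _ _ B2q); rewrite ltnn.
      + by move=> + /set1P kx; rewrite kx => /(xB _ _ B1q); rewrite ltnn.
      + exact: uni.
  apply/noncrossing_spec => B1 B2 /setU1P[->|B1q] /setU1P[->|B2q].
  - by rewrite eqxx.
  - by move=> _ a b c0 d /set1P -> _ /set1P ->; order_lia.
  - by move=> _ a b c0 d _ /set1P -> _ /set1P ->; order_lia.
  - exact: nc.
rewrite (eq_bigl _ _ Q) big_distrr /=; apply: eq_bigr => q Qq.
have xq : [set x] \notin q.
  move: Qq => /andP[/partition_spec[sub _ _ _] _].
  by apply/negP => /sub; rewrite sub1set inE ltnn.
by rewrite cardsU1 xq exprS.
Qed.

(** [glue] and [cut] are inverse bijections, and the number of blocks is
additive. *)
Lemma nc_weight_split :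
  (\sum_(p | nc_partition all p && ([set x] \notin p)) c ^+ #|p| =
   \sum_(j : 'I_n | (x < j < e)%N)
     nc_weight (segment x.+1 j) * nc_weight (segment j e))%R.
Proof.
rewrite (reindex_onto glue cut) /=; last first.
  by move=> p /andP[ncp xp]; have [] := cut_spec ncp xp.
have V t : (nc_partition all (glue t) && ([set x] \notin glue t)
    && (cut (glue t) == t)) = cut_valid t.
  apply/idP/idP => [/andP[/andP[ncg xg] /eqP ct]|/glue_spec[-> -> -> _]].
    by rewrite -ct; have [] := cut_spec ncg xg.
  by rewrite eqxx.
rewrite (eq_bigl _ _ V).
under [RHS]eq_bigr do rewrite /nc_weight big_distrlr pair_big /=.
rewrite pair_big_dep /=; apply: eq_bigr => t /glue_spec[_ _ _ ->].
by rewrite exprD.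
Qed.

Lemma nc_weight_rec : nc_weight all = (c * nc_weight rest +
   \sum_(j : 'I_n | (x < j < e)%N)
     nc_weight (segment x.+1 j) * nc_weight (segment j e))%R.
Proof.
rewrite {1}/nc_weight (bigID (fun p => [set x] \in p)) /=.
by rewrite nc_weight_singleton nc_weight_split.
Qed.

End NoncrossingRecursion.

(** The weight of a segment depends on its length only, and [nc_weight_rec] is the
recursion of the planar moments for the lengths. *)
Lemma sum_noncrossing (R : comNzRingType) (c : R) n :
  \sum_(p in NC n) c ^+ #|p| = planar_moment c 0 n.
Proof.
have main i e : (i <= e)%N -> (e <= n)%N ->
    nc_weight c (segment n i e) = planar_moment c 0 (e - i).
  move E : (e - i)%N => w; elim/ltn_ind: w i e E => w IHw i e E ie en.
  have [ei|{}ie] := leqP e i.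
    have -> : w = 0%N by order_lia.
    have -> : segment n i e = set0.
      by apply/setP => k; rewrite !inE; order_lia.
    rewrite /nc_weight (big_pred1 set0) ?cards0 // => p.
    rewrite /nc_partition partition_set0 /=; case: eqP => //= ->.
    by apply/noncrossing_spec => B1 B2; rewrite inE.
  have iN : (i < n)%N by exact: leq_trans ie en.
  rewrite (@nc_weight_rec n (Ordinal iN) e ie _ c) /=.
  case: w => [|w] in E IHw *; first by order_lia.
  rewrite planar_momentS mulr0 mul0r addr0 (IHw w) ?[in LHS]/=; try order_lia.
  congr (_ + _).
  transitivity (\sum_(j < n | (i < j < e)%N)
    planar_moment c 0 (j - i.+1) * planar_moment c 0 (e - j)).
    by apply: eq_bigr => j /andP[ij je]; congr (_ * _); apply: IHw; order_lia.
  transitivity (\sum_(i.+1 <= j < e)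
      planar_moment c 0 (j - i.+1) * planar_moment c 0 (e - j)).
    rewrite (big_nat_widen _ e n) // (big_nat_widenl i.+1 0) // big_mkord.
    by apply: eq_bigl => j; rewrite andbC.
  rewrite -[X in \sum_(X <= j < e) _]add0n big_addn.
  rewrite (_ : e - i.+1 = w)%N; last by order_lia.
  rewrite big_mkord; apply: eq_bigr => k _; rewrite addnK.
  by congr (_ * planar_moment _ _ _); order_lia.
rewrite -[in RHS](subn0 n) -main // /nc_weight.
apply: eq_bigl => p; rewrite inE /nc_partition.
congr (partition _ _ && _); apply/setP => k.
by rewrite !inE ltn_ord.
Qed.

(** * Generating functions through partial sums *)

(** Series are handled through their partial sums at a fixed small [u].  Sequences
of growth [L ^ n] have terms of size [8 ^ -n], which leaves room to absorb the
[N ^ 2] terms of the remainder of a Cauchy product into [2 ^ -N]. *)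
Section PartialSums.
Variables (K : numFieldType) (u L : K).
Hypotheses (L_ge0 : 0 <= L) (uL : `|u| * L <= 8^-1).
Implicit Types (a b f g : nat -> K).

Definition geo_null f := exists C, forall N, `|f N| <= C * 2^-1 ^+ N.

Definition bounded_seq f := exists C, forall N, `|f N| <= C.

Definition geo_bounded a := exists C, forall n, `|a n| <= C * L ^+ n.

Definition psum a N := \sum_(n < N) a n * u ^+ n.

(** The Cauchy product without its last term [a n * b 0]. *)
Definition convol a b n := \sum_(k < n) a k * b (n - k)%N.

Lemma geo_null_ext f g : f =1 g -> geo_null f -> geo_null g.
Proof. by move=> fg [C hC]; exists C => N; rewrite -fg. Qed.

Lemma geo_nullD f g : geo_null f -> geo_null g -> geo_null (fun N => f N + g N).
Proof.
move=> [C hC] [C' hC']; exists (C + C') => N; rewrite mulrDl.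
exact: le_trans (ler_normD _ _) (lerD (hC N) (hC' N)).
Qed.

Lemma geo_nullM f g : bounded_seq f -> geo_null g ->
  geo_null (fun N => f N * g N).
Proof.
move=> [C hC] [C' hC']; exists (C * C') => N; rewrite normrM -mulrA.
by apply: ler_pM.
Qed.

Lemma bounded_cst (x : K) : bounded_seq (fun=> x).
Proof. by exists `|x|. Qed.

Lemma geo_nullZ (x : K) f : geo_null f -> geo_null (fun N => x * f N).
Proof. exact: geo_nullM (bounded_cst x). Qed.

Lemma geo_nullB f g : geo_null f -> geo_null g -> geo_null (fun N => f N - g N).
Proof.
move=> f0 g0; apply: (geo_null_ext (f := fun N => f N + (- 1) * g N)).
  by move=> N; rewrite mulN1r.
by apply: geo_nullD => //; exact: geo_nullZ.
Qed.

Lemma geo_bounded_ge0 a C : (forall n, `|a n| <= C * L ^+ n) -> 0 <= C.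
Proof.
by move=> /(_ 0%N); rewrite expr0 mulr1; exact: le_trans (normr_ge0 _).
Qed.

Lemma geo_term a C n : (forall n, `|a n| <= C * L ^+ n) ->
  `|a n * u ^+ n| <= C * 8^-1 ^+ n.
Proof.
move=> hC; rewrite normrM normrX.
apply: (@le_trans _ _ (C * L ^+ n * `|u| ^+ n)).
  by rewrite ler_wpM2r ?exprn_ge0.
rewrite -mulrA -exprMn ler_wpM2l ?(geo_bounded_ge0 hC) //.
by rewrite lerXn2r ?nnegrE ?invr_ge0 ?mulr_ge0 // mulrC.
Qed.

Lemma eighth_le_half n : (8^-1 : K) ^+ n <= 2^-1 ^+ n.
Proof. by rewrite lerXn2r ?nnegrE ?invr_ge0 // lef_pV2 ?posrE // ler_nat. Qed.

Lemma geo_term_null a : geo_bounded a -> geo_null (fun N => a N * u ^+ N).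
Proof.
move=> [C hC]; exists C => N; apply: le_trans (geo_term N hC) _.
by rewrite ler_wpM2l ?(geo_bounded_ge0 hC) ?eighth_le_half.
Qed.

Lemma sum_half_le N : \sum_(n < N) (2^-1 : K) ^+ n <= 2.
Proof.
suff -> : \sum_(n < N) (2^-1 : K) ^+ n = 2 - 2 * 2^-1 ^+ N.
  by rewrite gerBl mulr_ge0 ?exprn_ge0 ?invr_ge0.
elim: N => [|N IHN]; first by rewrite big_ord0 expr0 mulr1 subrr.
rewrite big_ord_recr /= IHN exprS mulrA divff ?pnatr_eq0 // mul1r.
by ring.
Qed.

Lemma psum_le a C N : (forall n, `|a n| <= C * L ^+ n) -> `|psum a N| <= C * 2.
Proof.
move=> hC; apply: le_trans (ler_norm_sum _ _ _) _.
apply: (@le_trans _ _ (\sum_(n < N) C * 2^-1 ^+ n)).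
  apply: ler_sum => n _; apply: le_trans (geo_term n hC) _.
  by rewrite ler_wpM2l ?(geo_bounded_ge0 hC) ?eighth_le_half.
by rewrite -mulr_sumr ler_wpM2l ?(geo_bounded_ge0 hC) ?sum_half_le.
Qed.

Lemma psum_bounded a : geo_bounded a -> bounded_seq (psum a).
Proof. by move=> [C hC]; exists (C * 2) => N; exact: psum_le. Qed.

(** Multiplication by [u] shifts a power series; the last term is the truncation
error. *)
Lemma psum_shift a N :
  psum a N = a 0%N + u * psum (fun n => a n.+1) N - a N * u ^+ N.
Proof.
apply/eqP; rewrite eq_sym subr_eq; apply/eqP.
transitivity (psum a N.+1); last by rewrite /psum big_ord_recr.
rewrite /psum big_ord_recl expr0 mulr1 mulr_sumr; congr (_ + _).
by apply: eq_bigr => n _; rewrite mulrCA -exprS.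
Qed.

Lemma sum_triangle (F : nat -> nat -> K) N :
  \sum_(n < N) \sum_(k < n.+1) F k (n - k)%N =
  \sum_(i < N) \sum_(j < N | (i + j < N)%N) F i j.
Proof.
transitivity (\sum_(n < N) \sum_(k < N | (k < n.+1)%N) F k (n - k)%N).
  by apply: eq_bigr => n _; rewrite (big_ord_widen N (fun k => F k (n - k)%N)).
rewrite (exchange_big_dep predT) //=; apply: eq_bigr => i _.
transitivity (\sum_(i <= n < N) F i (n - i)%N).
  by rewrite (big_nat_widenl i 0) // big_mkord.
rewrite -{1}[nat_of_ord i]add0n big_addn (big_nat_widen 0 _ N) ?leq_subr //.
rewrite big_mkord.
by apply: eq_big => [j|j _]; rewrite ?addnK //= addnC ltn_subRL addnC.
Qed.

(** The difference consists of the terms with [i, j < N <= i + j]: at most [N ^ 2]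
terms of size [8 ^ -N], and [N ^ 2 <= 4 ^ N]. *)
Lemma psum_convol_null a b : geo_bounded a -> geo_bounded b ->
  geo_null (fun N => psum (convol a b) N - psum a N * (psum b N - b 0%N)).
Proof.
move=> [A hA] [B hB]; exists (A * B) => N.
have A0 := geo_bounded_ge0 hA; have B0 := geo_bounded_ge0 hB.
pose F i j := a i * u ^+ i * (b j * u ^+ j).
have convE : psum (convol a b) N =
    \sum_(n < N) \sum_(k < n.+1) F k (n - k)%N - psum a N * b 0%N.
  rewrite /psum mulr_suml -sumrB; apply: eq_bigr => n _.
  rewrite big_ord_recr /= subnn /F expr0 mulr1 mulrAC addrK mulr_suml.
  apply: eq_bigr => k _; rewrite mulrACA -exprD subnKC //.
  exact/ltnW/ltn_ord.
have cancel (x y w : K) : x - y - (w - y) = x - w by ring.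
rewrite convE mulrBr cancel sum_triangle.
rewrite big_distrlr /= -sumrB.
have -> : \sum_(i < N) (\sum_(j < N | (i + j < N)%N) F i j - \sum_(j < N) F i j)
    = \sum_(i < N) - \sum_(j < N | (N <= i + j)%N) F i j.
  apply: eq_bigr => i _.
  rewrite [X in _ - X](bigID (fun j : 'I_N => (i + j < N)%N)) /=.
  rewrite opprD addrA subrr add0r; congr (- _).
  by apply: eq_bigl => j; rewrite -leqNgt.
apply: le_trans (ler_norm_sum _ _ _) _.
apply: (@le_trans _ _ (\sum_(i < N) \sum_(j < N) A * B * 8^-1 ^+ N)).
  apply: ler_sum => i _; rewrite normrN; apply: le_trans (ler_norm_sum _ _ _) _.
  rewrite [in leRHS](bigID (fun j : 'I_N => (N <= i + j)%N)) /=.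
  rewrite -[leLHS]addr0 lerD //.
    apply: ler_sum => j Nij; rewrite normrM.
    apply: (@le_trans _ _ (A * 8^-1 ^+ i * (B * 8^-1 ^+ j))).
      by apply: ler_pM => //; exact: geo_term.
    rewrite mulrACA -exprD ler_wpM2l ?mulr_ge0 //.
    by rewrite ler_wiXn2l ?invr_ge0 // invf_le1 // ler1n.
  by apply: sumr_ge0 => j _; rewrite !mulr_ge0 ?exprn_ge0 ?invr_ge0.
rewrite !sumr_const !card_ord -!mulrnA -mulrnAr ler_wpM2l ?mulr_ge0 //.
rewrite -mulr_natl natrM.
have -> : (8 : K) = 2 * (2 * 2) by rewrite -!natrM.
have half_le : N%:R * (2^-1 : K) ^+ N <= 1.
  rewrite exprVn ler_pdivrMr ?exprn_gt0 // mul1r -natrX ler_nat.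
  exact/ltnW/ltn_expl.
rewrite !invfM !exprMn mulrCA ger_pMr ?exprn_gt0 ?invr_gt0 //.
rewrite mulrACA mulr_ile1 // ?mulr_ge0 ?exprn_ge0 ?invr_ge0 //.
Qed.

Variables (c c' : K) (m h : nat -> K).
Hypotheses (m0 : m 0%N = 1) (h0 : h 0%N = 0).
Hypothesis mS : forall n, m n.+1 = c * m n + convol m m n.
Hypothesis hS : forall n, h n.+1 =
  c' * m n + c * h n + (convol h m n + convol m h n) + n%:R * m n.
Let d n := n%:R * m n.
Hypotheses (m_geo : geo_bounded m) (h_geo : geo_bounded h) (d_geo : geo_bounded d).

Lemma eq_of_diff (x y p q : K) : p = q -> x - y = p - q -> x = y.
Proof. by move=> ->; rewrite subrr => /subr0_eq. Qed.

Lemma psumD a b N : psum (fun n => a n + b n) N = psum a N + psum b N.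
Proof. by rewrite /psum -big_split /=; apply: eq_bigr => n _; rewrite mulrDl. Qed.

Lemma psumZ x a N : psum (fun n => x * a n) N = x * psum a N.
Proof. by rewrite /psum mulr_sumr; apply: eq_bigr => n _; rewrite mulrA. Qed.

Lemma eq_psum a b N : a =1 b -> psum a N = psum b N.
Proof. by move=> ab; apply: eq_bigr => n _; rewrite ab. Qed.

(** The Euler operator is a derivation for convolution, since
[k + (n - k) = n]. *)
Lemma euler_recursion n : d n.+1 = m n.+1 + c * d n + (convol d m n + convol m d n).
Proof.
have -> : convol d m n + convol m d n = n%:R * convol m m n.
  rewrite mulr_sumr -big_split; apply: eq_bigr => k _ /=.
  rewrite /d mulrCA -mulrA -mulrDl -natrD subnKC //.
  exact/ltnW/ltn_ord.
by rewrite /d mulrCA -addrA -mulrDr -mS -natr1 mulrDl mul1r addrC.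
Qed.

Local Notation Mn := (psum m).
Local Notation Dn := (psum d).
Local Notation Hn := (psum h).

Lemma psum_m_null :
  geo_null (fun N => Mn N - 1 - u * (c * Mn N + Mn N * (Mn N - 1))).
Proof.
have := geo_nullB (geo_nullZ u (psum_convol_null m_geo m_geo)) (geo_term_null m_geo).
apply: geo_null_ext => N; have := psum_shift m N.
rewrite (eq_psum _ mS) psumD psumZ m0 => /eqP.
rewrite -addrA addrC -subr_eq => /eqP ->.
by ring.
Qed.

Lemma psum_d_null : geo_null (fun N => Dn N - (Mn N - 1)
  - u * (c * Dn N + Dn N * (Mn N - 1) + Mn N * Dn N)).
Proof.
have dm := psum_convol_null d_geo m_geo; have md := psum_convol_null m_geo d_geo.
have := geo_nullD (geo_nullZ u (geo_nullD dm md))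
  (geo_nullB (geo_term_null m_geo) (geo_term_null d_geo)).
apply: geo_null_ext => N.
have d0 : d 0%N = 0 by rewrite /d mul0r.
have Em := psum_shift m N; have Ed := psum_shift d N; rewrite m0 in Em.
rewrite d0 (eq_psum _ euler_recursion) !psumD psumZ in Ed; rewrite m0 d0.
apply: (eq_of_diff (congr2 +%R (esym Ed) Em)).
by ring.
Qed.

Lemma psum_h_null : geo_null (fun N => Hn N
  - u * (c' * Mn N + c * Hn N + (Hn N * (Mn N - 1) + Mn N * Hn N) + Dn N)).
Proof.
have hm := psum_convol_null h_geo m_geo; have mh := psum_convol_null m_geo h_geo.
have := geo_nullB (geo_nullZ u (geo_nullD hm mh)) (geo_term_null h_geo).
apply: geo_null_ext => N; have Eh := psum_shift h N.
rewrite h0 (eq_psum _ hS) !psumD !psumZ in Eh; rewrite m0 h0.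
apply: (eq_of_diff (esym Eh)).
by ring.
Qed.

Variables (z S B : K).
Hypotheses (z_neq0 : z != 0) (u_def : u = z^-1).
Hypothesis S_sqr : S ^+ 2 = z ^+ 2 - 2 * (1 + c) * z + (1 - c) ^+ 2.
Hypothesis S_near : `|S / z - 1| <= 2^-1.
Hypothesis Mn_le : forall N, `|Mn N| <= B.
Hypothesis z_large : 2 * (`|1 - c| + 2 * B) <= `|z|.

Definition planar_series := (z + 1 - c - S) / 2.

Lemma S_neq0 : S != 0.
Proof.
apply: contraTneq S_near => ->; rewrite mul0r sub0r normrN1.
by rewrite lt_geF // invf_lt1 ?ltr0n // ltr1n.
Qed.

(** Put [A = z + 1 - c - 2 Mn].  Then [(A - S) (A + S)] is [- 4 z] times a
geometrically small quantity, and [A + S] stays away from 0, as both terms are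
close to [z]. *)
Lemma psum_m_cvg : geo_null (fun N => Mn N - planar_series).
Proof.
have half_z : `|S - z| <= `|z| * 2^-1.
  have -> : S - z = z * (S / z - 1) by rewrite mulrBr mulr1 mulrC divfK.
  by rewrite normrM ler_wpM2l.
pose A N := z + 1 - c - 2 * Mn N.
have A_far N : `|z| <= `|A N + S|.
  have AE : A N + S = 2 * z - ((z - S) + (2 * Mn N - (1 - c))).
    by rewrite /A; ring.
  have small : `|(z - S) + (2 * Mn N - (1 - c))| <= `|z|.
    apply: le_trans (ler_normD _ _) _.
    have -> : `|z| = `|z| * 2^-1 + `|z| * 2^-1 by rewrite -mulrDr; field.
    rewrite lerD ?[`|z - S|]distrC //.
    rewrite ler_pdivlMr // mulrC; apply: (le_trans _ z_large).
    rewrite ler_wpM2l //; apply: le_trans (ler_normB _ _) _.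
    by rewrite addrC lerD // normrM normr_nat ler_wpM2l.
  rewrite AE; apply: (le_trans _ (lerB_dist _ _)).
  rewrite [`|2 * z|]normrM normr_nat lerBrDr.
  have -> : 2 * `|z| = `|z| + `|z| by ring.
  by rewrite lerD2l.
have [C hC] := psum_m_null.
exists (2 * C) => N.
have key : (A N - S) * (A N + S) =
    - (4 * z) * (Mn N - 1 - u * (c * Mn N + Mn N * (Mn N - 1))).
  rewrite -subr_sqr S_sqr u_def /A; field; exact: z_neq0.
have z0 : 0 < `|z| by rewrite normr_gt0.
have bound : `|A N - S| <= 4 * (C * 2^-1 ^+ N).
  rewrite -(ler_pM2r z0); apply: le_trans (_ : `|A N - S| * `|A N + S| <= _).
    by rewrite ler_wpM2l.
  rewrite -normrM key normrM normrN normrM normr_nat.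
  rewrite mulrAC.
  by rewrite ler_wpM2r // ler_wpM2l.
have -> : Mn N - planar_series = - ((A N - S) / 2).
  by rewrite /planar_series /A; field.
rewrite normrN normrM [`|2^-1|]ger0_norm ?invr_ge0 // ler_pdivrMr //.
by apply: le_trans bound _; rewrite le_eqVlt; apply/orP; left; apply/eqP; ring.
Qed.

Definition derivative_series := z * (planar_series - 1) / S.

(** By [psum_d_null], [u A Dn] is close to [Mn - 1], where [A = z + 1 - c - 2 Mn]
tends to [S]. *)
Lemma psum_d_cvg : geo_null (fun N => Dn N - derivative_series).
Proof.
have Db : bounded_seq (fun N => 2 * u * Dn N + 1).
  have [C hC] := psum_bounded d_geo; exists (`|2 * u| * C + 1) => N.
  apply: le_trans (ler_normD _ _) _.
  by rewrite normr1 lerD2r normrM ler_wpM2l.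
apply: geo_null_ext (geo_nullZ (z / S)
  (geo_nullD psum_d_null (geo_nullM Db psum_m_cvg))) => N.
rewrite /derivative_series /planar_series u_def; field.
by rewrite S_neq0 z_neq0.
Qed.

Definition linearized_series := (c' * planar_series + derivative_series) / S.

(** By [psum_h_null], [A Hn] is close to [c' Mn + Dn], where
[A = z + 1 - c - 2 Mn] tends to [S]. *)
Lemma psum_h_cvg : geo_null (fun N => Hn N - linearized_series).
Proof.
apply: geo_null_ext (geo_nullZ S^-1 (geo_nullD (geo_nullZ z psum_h_null)
  (geo_nullD (geo_nullD (geo_nullZ c' psum_m_cvg) psum_d_cvg)
    (geo_nullZ 2 (geo_nullM (psum_bounded h_geo) psum_m_cvg))))) => N.
rewrite /linearized_series /derivative_series /planar_series u_def; field.
by rewrite S_neq0 z_neq0.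
Qed.

Variables a b : K.
Hypotheses (sum_ab : a + b = 2 * (1 + c)) (prod_ab : a * b = (1 - c) ^+ 2).

Lemma sqr_factor : (z - a) * (z - b) = S ^+ 2.
Proof. by rewrite S_sqr -sum_ab -prod_ab; ring. Qed.

Lemma planar_seriesE (Sz_neq0 : S + z - 1 + c != 0) :
  planar_series = - (((1 - c) ^+ 2 - (1 + c) * z - (1 - c) * S)
                     / (S + z - 1 + c)).
Proof.
rewrite /planar_series -mulNr; apply/eqP.
rewrite eqr_div ?pnatr_eq0 //; apply/eqP.
have -> : (z + 1 - c - S) * (S + z - 1 + c)
    = z ^+ 2 - (1 - c) ^+ 2 + 2 * (1 - c) * S - S ^+ 2 by ring.
by rewrite S_sqr; ring.
Qed.

(** The left-hand side is [(planar_series - 1) / S ^ 2], and the partial fractions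
add up to [2 (z - 1 - c) / S ^ 2]. *)
Lemma derivative_seriesE :
  derivative_series / (z * S) = 2^-1 * (2^-1 * ((z - a)^-1 + (z - b)^-1) - S^-1).
Proof.
have S0 := S_neq0.
have : (z - a) * (z - b) != 0 by rewrite sqr_factor expf_neq0.
rewrite mulf_eq0 negb_or => /andP[za0 zb0].
have -> : (z - a)^-1 + (z - b)^-1 = 2 * (z - 1 - c) / S ^+ 2.
  rewrite -sqr_factor (_ : 2 * (z - 1 - c) = (z - a) + (z - b)).
    by field; rewrite za0 zb0.
  by rewrite addrACA -opprD sum_ab; ring.
by rewrite /derivative_series /planar_series; field; rewrite S0 z_neq0.
Qed.

Lemma linearized_seriesE (Sz_neq0 : S + z - 1 + c != 0) :
  z^-1 * linearized_series =
  - c' / (z * S) * (((1 - c) ^+ 2 - (1 + c) * z - (1 - c) * S)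
                    / (S + z - 1 + c))
  + 2^-1 * (2^-1 * ((z - a)^-1 + (z - b)^-1) - S^-1).
Proof.
rewrite -derivative_seriesE mulNr mulNr -mulrN -planar_seriesE //.
by rewrite /linearized_series; field; rewrite S_neq0 z_neq0.
Qed.

End PartialSums.

(** * Exponential growth of the moment sequences *)

Section GrowthBounds.
Variables (R : realFieldType) (c c' : R).
Hypothesis c_gt0 : 0 < c.
Local Notation m := (planar_moment c 0).
Local Notation h := (linearized_moment c c').
Local Notation K := (2 * c + 4).

Lemma growth_base_gt0 : 0 < K.
Proof. by have := c_gt0; lra. Qed.

Lemma planar_moment_ge0 n : 0 <= m n.
Proof.
elim/ltn_ind: n => -[_|n IHn]; first by rewrite planar_moment0.
rewrite planar_momentS mulr0 mul0r addr0 addr_ge0 //.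
  by rewrite mulr_ge0 ?IHn // ltW.
apply: sumr_ge0 => k _; have kn := ltn_ord k.
by rewrite mulr_ge0 // IHn //; lia.
Qed.

Lemma psum_convol_le (u : R) (a b : nat -> R) N : 0 <= u ->
  (forall n, 0 <= a n) -> (forall n, 0 <= b n) ->
  psum u (convol a b) N <= psum u a N * psum u b N.
Proof.
move=> u0 a0 b0; pose F i j := a i * u ^+ i * (b j * u ^+ j).
have F0 i j : 0 <= F i j by rewrite !mulr_ge0 ?exprn_ge0.
apply: (@le_trans _ _ (\sum_(n < N) \sum_(k < n.+1) F k (n - k)%N)).
  apply: ler_sum => n _; rewrite big_ord_recr /= mulr_suml.
  rewrite -[leLHS]addr0 lerD // ler_sum // => k _.
  by rewrite /F mulrACA -exprD subnKC // ltnW.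
rewrite sum_triangle /psum big_distrlr /=; apply: ler_sum => i _.
rewrite [leRHS](bigID (fun j : 'I_N => (i + j < N)%N)) /=.
by rewrite lerDl; apply: sumr_ge0 => j _; exact: F0.
Qed.

(** Induction on the truncation order: if the partial sum at [1 / K] is at most 2,
the quadratic recursion bounds the next one by [1 + (2 c + 4) / K = 2]. *)
Lemma psum_planar_le2 N : psum K^-1 m N <= 2.
Proof.
have K0 := growth_base_gt0.
have t0 : 0 <= K^-1 by rewrite invr_ge0 ltW.
elim: N => [|N IHN]; first by rewrite /psum big_ord0.
have p0 : 0 <= psum K^-1 m N.
  by apply: sumr_ge0 => n _; rewrite mulr_ge0 ?exprn_ge0 ?planar_moment_ge0.
have -> : psum K^-1 m N.+1 = 1 + K^-1 * psum K^-1 (fun n => m n.+1) N.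
  rewrite /psum big_ord_recl planar_moment0 mul1r expr0 mulr_sumr.
  by congr (_ + _); apply: eq_bigr => n _; rewrite mulrCA -exprS.
have -> : psum K^-1 (fun n => m n.+1) N
    = c * psum K^-1 m N + psum K^-1 (convol m m) N.
  rewrite -psumZ -psumD; apply: eq_psum => n.
  by rewrite planar_momentS mulr0 mul0r addr0.
have := psum_convol_le N t0 planar_moment_ge0 planar_moment_ge0.
have tK : K^-1 * K = 1 by rewrite mulVf // gt_eqF.
move: (psum _ (convol _ _) _) => q; move: (psum _ _ _) p0 IHN => p p0 p2 qp.
have pp : p * p <= 4 by nra.
have cp : c * p <= c * 2 by rewrite ler_wpM2l // ltW.
by rewrite -lerBrDl mulrC ler_pdivrMr //; lra.
Qed.

Lemma planar_moment_le n : m n <= 2 * K ^+ n.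
Proof.
have K0 := growth_base_gt0.
rewrite -ler_pdivrMr ?exprn_gt0 // -exprVn.
apply: le_trans (psum_planar_le2 n.+1); rewrite /psum big_ord_recr /= lerDr.
apply: sumr_ge0 => k _.
by rewrite mulr_ge0 ?exprn_ge0 ?planar_moment_ge0 // invr_ge0 ltW.
Qed.

(** Large enough to dominate [planar_moment], its multiple by [n], and, through
the constant terms, the coefficients of the recursion of
[linearized_moment]. *)
Definition growth_rate : R := 2 * K + 2 * `|c'| + c + 10.
Local Notation L := growth_rate.

Lemma growth_rate_gt0 : 0 < L.
Proof. by rewrite /L; have := normr_ge0 c'; have := c_gt0; lra. Qed.

Lemma growth_rate_ge2K : 2 * K <= L.
Proof. by rewrite /L; have := normr_ge0 c'; have := c_gt0; lra. Qed.

Lemma planar_moment_geo n : m n <= 2 * L ^+ n.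
Proof.
apply: le_trans (planar_moment_le n) _; rewrite ler_wpM2l //; apply: lerXn2r; rewrite ?nnegrE //.
- exact/ltW/growth_base_gt0.
- exact/ltW/growth_rate_gt0.
- by have := growth_rate_ge2K; have := c_gt0; lra.
Qed.

Lemma planar_derivative_geo n : n%:R * m n <= 2 * L ^+ n.
Proof.
apply: (@le_trans _ _ (2 ^+ n * (2 * K ^+ n))).
  apply: ler_pM; rewrite ?planar_moment_ge0 ?planar_moment_le //.
  by rewrite -natrX ler_nat ltnW // ltn_expl.
rewrite mulrCA -exprMn ler_wpM2l //; apply: lerXn2r; rewrite ?nnegrE //.
- by have := growth_base_gt0; lra.
- exact/ltW/growth_rate_gt0.
- exact: growth_rate_ge2K.
Qed.

Lemma sum_powers_le n : \sum_(k < n) L ^+ k * K ^+ (n - k) <= L ^+ n.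
Proof.
have K0 := growth_base_gt0.
have [L0 L2] := (growth_rate_gt0, growth_rate_ge2K).
elim: n => [|n IHn]; first by rewrite big_ord0.
rewrite big_ord_recr /= subSnn expr1.
have -> : \sum_(k < n) L ^+ k * K ^+ (n.+1 - k)
    = K * \sum_(k < n) L ^+ k * K ^+ (n - k).
  rewrite mulr_sumr; apply: eq_bigr => k _.
  by rewrite subSn ?exprS 1?mulrCA // ltnW.
have Ln : 0 <= L ^+ n by rewrite exprn_ge0 // ltW.
rewrite exprS; nra.
Qed.

Lemma sum_powers_le2 n : \sum_(k < n) K ^+ k * L ^+ (n - k) <= 2 * L ^+ n.
Proof.
have K0 := growth_base_gt0.
have [L0 L2] := (growth_rate_gt0, growth_rate_ge2K).
elim: n => [|n IHn]; first by rewrite big_ord0 expr0; lra.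
rewrite big_ord_recl expr0 mul1r subn0.
have -> : \sum_(k < n) K ^+ (lift ord0 k) * L ^+ (n.+1 - lift ord0 k)
    = K * \sum_(k < n) K ^+ k * L ^+ (n - k).
  rewrite mulr_sumr; apply: eq_bigr => k _.
  by rewrite lift0 subSS exprS mulrA.
have Ln : 0 <= L ^+ n by rewrite exprn_ge0 // ltW.
rewrite exprS; nra.
Qed.

(** Each term of the recursion is at most a constant times [L ^ n], and these
constants add up to at most [L]. *)
Lemma linearized_moment_geo n : `|h n| <= L ^+ n.
Proof.
have K0 := growth_base_gt0.
have L0 := growth_rate_gt0.
elim/ltn_ind: n => -[_|n IHn].
  by rewrite linearized_moment0 normr0 expr0.
have Ln : 0 <= L ^+ n by rewrite exprn_ge0 // ltW.
have hn : `|h n| <= L ^+ n by exact: IHn.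
have mb : `|m n| <= 2 * L ^+ n.
  by rewrite ger0_norm ?planar_moment_ge0 ?planar_moment_geo.
have db : `|n%:R * m n| <= 2 * L ^+ n.
  by rewrite ger0_norm ?planar_derivative_geo // mulr_ge0 ?planar_moment_ge0.
have sb : `|\sum_(k < n) (h k * m (n - k)%N + m k * h (n - k)%N)| <= 6 * L ^+ n.
  apply: le_trans (ler_norm_sum _ _ _) _.
  apply: (@le_trans _ _ (2 * \sum_(k < n) L ^+ k * K ^+ (n - k)
                         + 2 * \sum_(k < n) K ^+ k * L ^+ (n - k))); last first.
    by have := sum_powers_le n; have := sum_powers_le2 n; lra.
  rewrite !mulr_sumr -big_split /=; apply: ler_sum => k _.
  have kn := ltn_ord k.
  apply: le_trans (ler_normD _ _) _; rewrite !normrM.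
  rewrite ![`|m _|]ger0_norm ?planar_moment_ge0 //; apply: lerD.
    rewrite mulrCA; apply: ler_pM; rewrite ?planar_moment_ge0 //.
      by apply: IHn; lia.
    exact: planar_moment_le.
  rewrite mulrA; apply: ler_pM; rewrite ?planar_moment_ge0 ?planar_moment_le //.
  have [k0|k0] := posnP k; last by apply: IHn; lia.
  by rewrite k0 subn0.
rewrite linearized_momentS.
apply: le_trans (ler_normD _ _) _; apply: le_trans (lerD (ler_normD _ _) (lexx _)) _.
apply: le_trans (lerD (lerD (ler_normD _ _) (lexx _)) (lexx _)) _.
rewrite [`|c' * _|]normrM [`|c * _|]normrM (gtr0_norm c_gt0) exprS.
have cm : `|c'| * `|m n| <= `|c'| * (2 * L ^+ n) by rewrite ler_wpM2l.
have ch : c * `|h n| <= c * L ^+ n by rewrite ler_wpM2l // ltW.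
rewrite [L in leRHS]/growth_rate.
by nra.
Qed.

End GrowthBounds.

From mathcomp Require Import complex.
From mathcomp Require Import -(notations) freeg mpoly.
From mathcomp Require Import all_classical all_reals all_analysis.
From mathcomp Require Import measurable_realfun.

Import numFieldNormedType.Exports.

Local Open Scope classical_set_scope.
Local Open Scope complex_scope.

(** * Integration by parts on polynomial rings *)

Section GaussianFunctional.
Variables (R : comNzRingType) (n : nat) (L : {scalar mpoly n R}) (gm : nat -> R).
Hypothesis L_monomial : forall m, L (mpolyX R m) = \prod_k gm (m k).
Hypotheses (gm0 : gm 0%N = 1) (gm1 : gm 1%N = 0).
Hypothesis gmSS : forall a, gm a.+2 = a.+1%:R * gm a.

(** By linearity it suffices to treat monomials, where the formula is the
recursion of the one-variable moments. *)
Lemma gaussian_functional_Stein k (p : mpoly n R) :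
  L (mpolyX R (mnm1 k) * p) = L (mderiv k p).
Proof.
rewrite [p]mpolyE mulr_sumr [mderiv k _]raddf_sum !raddf_sum /=.
apply: eq_bigr => m _.
rewrite -scalerAr [mderiv k _]linearZ !linearZ /=; congr (_ * _).
rewrite -mpolyXD mderivX linearZ /= !L_monomial (bigD1 k) //=.
rewrite [in RHS](bigD1 k) //= mulrA.
rewrite mnmDE mnmBE mnm1E eqxx add1n; congr (_ * _); last first.
  by apply: eq_bigr => j /negbTE jk; rewrite mnmDE mnmBE mnm1E eq_sym jk subn0.
by case: (m k) => [|a]; rewrite ?gm1 ?mul0r // gmSS subn1.
Qed.

Lemma gaussian_functional1 : L 1 = 1.
Proof.
by rewrite -mpolyX0 L_monomial big1 // => k _; rewrite mnm0E gm0.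
Qed.

End GaussianFunctional.

Section GaussianMatrixFunctional.
Variables (R : fieldType) (N M : nat) (L : {scalar mpoly (N * M) R}).
Variable gm : nat -> R.
Hypothesis L_monomial : forall m, L (mpolyX R m) = \prod_k gm (m k).
Hypotheses (gm0 : gm 0%N = 1) (gm1 : gm 1%N = 0).
Hypothesis gmSS : forall a, gm a.+2 = a.+1%:R * gm a.

(** The matrix whose entries are the variables of the polynomial ring. *)
Definition generic_matrix : 'M[mpoly (N * M) R]_(N, M) :=
  \matrix_(i, j) mpolyX R (mnm1 (mxvec_index i j)).

Lemma mderiv_generic_matrix i j :
  map_mx (mderiv (mxvec_index i j)) generic_matrix = delta_mx i j.
Proof.
apply/matrixP => k l; rewrite !mxE mderivX mnm1E.
have -> : (mxvec_index k l == mxvec_index i j) = (k == i) && (l == j).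
  apply/eqP/andP => [|[/eqP -> /eqP ->] //].
  case/cast_ord_inj/enum_rank_inj => -> ->.
  by rewrite !eqxx.
case: andP => [[/eqP -> /eqP ->]|_]; last by rewrite scale0r.
rewrite scale1r -[RHS]mpolyX0; congr mpolyX; apply/mnmP => t.
  by rewrite mnmBE mnm0E subnn.
Qed.

Lemma generic_trace_moment_S n s (N0 : N%:R != 0 :> R) :
  let E := trace_moment L generic_matrix in
  E (n.+1 :: s) =
  M%:R / N%:R * E (n :: s)
  + \sum_(k < n) E [:: k : nat, (n - k)%N & s]
  + n%:R / N%:R * E (n :: s)
  + N%:R ^- 2 * \sum_(cs <- merges n s) cs.1%:R * E cs.2.
Proof.
apply: (@trace_moment_S _ _ L _ _ generic_matrix
  (fun i j => mderiv (mxvec_index i j))) => //.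
- by move=> i j x y; exact: mderivM.
- exact: mderiv_generic_matrix.
- by move=> i j x; rewrite mxE; exact: (gaussian_functional_Stein L_monomial).
Qed.

End GaussianMatrixFunctional.

(** * Limit of the first order correction *)

Lemma cvg_sum (K : numFieldType) (V : normedModType K) (I : Type) (r : seq I)
    (f : I -> nat -> V) (l : I -> V) :
  (forall i, f i @ \oo --> l i) ->
  (fun n => \sum_(i <- r) f i n) @ \oo --> \sum_(i <- r) l i.
Proof. by move=> fl; apply: cvg_big => //; exact: add_continuous. Qed.

Section LimitMoments.
Variables (R : realType) (c c' : R) (x : nat -> R).
Hypothesis x_cvg : x @ \oo --> c.
Hypothesis x_rate : (fun N => N%:R * (x N - c)) @ \oo --> c'.

Local Notation mu N := (planar_moment (x N) N%:R^-1).
Local Notation m := (planar_moment c 0).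

Lemma cvg_natV : (fun N => N%:R^-1 : R) @ \oo --> 0.
Proof.
apply/gtr0_cvgV0; last exact: cvgr_idn.
by near=> N; rewrite ltr0n; near: N; exists 1%N.
Unshelve. all: by end_near. Qed.

Lemma planar_moment_cvg n : (fun N => mu N n) @ \oo --> m n.
Proof.
elim/ltn_ind: n => -[_|n IHn]; first exact: cvg_cst.
rewrite planar_momentS; under eq_fun do rewrite planar_momentS.
have IH k : (k <= n)%N -> (fun N => mu N k) @ \oo --> m k by move=> /IHn.
apply: cvgD; first apply: cvgD.
- by apply: cvgM => //; exact: IH.
- apply: cvg_sum => k.
  by apply: cvgM; apply: IH; have := ltn_ord k; lia.
apply: cvgM; last exact: IH.
by apply: cvgM; [exact: cvg_cst|exact: cvg_natV].
Qed.

(** [N (mu_(n+1) - m_(n+1))] is a combination of [N (x - c)], of the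
[N (mu_k - m_k)] with [k <= n] and of [n mu_n], by subtracting the recursions. *)
Lemma linearized_moment_cvg n :
  (fun N => N%:R * (mu N n - m n)) @ \oo --> linearized_moment c c' n.
Proof.
elim/ltn_ind: n => -[_|n IHn].
  rewrite linearized_moment0; under eq_fun do rewrite !planar_moment0 subrr mulr0.
  exact: cvg_cst.
have IH k : (k <= n)%N ->
  (fun N => N%:R * (mu N k - m k)) @ \oo --> linearized_moment c c' k.
  by move=> /IHn.
rewrite linearized_momentS.
(* The difference of the two recursions, with each product split as
   [x' y' - x y = (x' - x) y' + x (y' - y)]. *)
have key : \forall N \near \oo,
    N%:R * (x N - c) * mu N n + c * (N%:R * (mu N n - m n))
    + \sum_(k < n) (N%:R * (mu N k - m k) * mu N (n - k)%N
                    + m k * (N%:R * (mu N (n - k)%N - m (n - k)%N)))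
    + n%:R * mu N n = N%:R * (mu N n.+1 - m n.+1).
  near=> N.
  have N0 : N%:R != 0 :> R by rewrite pnatr_eq0 -lt0n; near: N; exists 1%N.
  have -> : \sum_(k < n) (N%:R * (mu N k - m k) * mu N (n - k)%N
       + m k * (N%:R * (mu N (n - k)%N - m (n - k)%N))) =
     N%:R * (\sum_(k < n) mu N k * mu N (n - k)%N
             - \sum_(k < n) m k * m (n - k)%N).
    by rewrite -sumrB mulr_sumr; apply: eq_bigr => k _; ring.
  by rewrite !planar_momentS; field.
apply: cvg_trans (near_eq_cvg key) _ => /=.
apply: cvgD; first apply: cvgD; first apply: cvgD.
- by apply: cvgM => //; exact: planar_moment_cvg.
- by apply: cvgM; [exact: cvg_cst|exact: IH].
- apply: cvg_sum => k; have kn := ltn_ord k.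
  apply: cvgD; apply: cvgM.
  + by apply: IH; lia.
  + exact: planar_moment_cvg.
  + exact: cvg_cst.
  + by apply: IH; lia.
by apply: cvgM; [exact: cvg_cst|exact: planar_moment_cvg].
Unshelve. all: by end_near. Qed.

Lemma cvg_power_bounded2 (u : nat -> R) : power_bounded 2 u ->
  (fun N => N%:R * u N) @ \oo --> 0.
Proof.
move=> [C hC]; apply/norm_cvg0P.
apply: (@squeeze_cvgr _ _ _ _ (cst 0) (fun N => C * N%:R^-1)).
- near=> N; have N0 : (0 < N)%N by near: N; exists 1%N.
  rewrite /cst normr_ge0 /= normrM normr_nat.
  have NR0 : N%:R != 0 :> R by rewrite pnatr_eq0 -lt0n.
  rewrite (_ : C * _ = N%:R * (C * N%:R ^- 2)); first by rewrite ler_wpM2l // hC.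
  by field.
- exact: cvg_cst.
- rewrite -[X in _ --> X](mulr0 C).
  by apply: cvgM; [exact: cvg_cst|exact: cvg_natV].
Unshelve. all: by end_near. Qed.

Lemma moment_expansion_cvg n (e : nat -> R) :
  power_bounded 2 (fun N => e N - mu N n) ->
  (fun N => N%:R * (e N - m n)) @ \oo --> linearized_moment c c' n.
Proof.
move=> /cvg_power_bounded2 e0; rewrite -[X in _ --> X]add0r.
have -> : (fun N => N%:R * (e N - m n)) =
    (fun N => N%:R * (e N - mu N n) + N%:R * (mu N n - m n)).
  by apply/funext => N; rewrite -mulrDr addrA subrK.
by apply: cvgD => //; exact: linearized_moment_cvg.
Qed.

End LimitMoments.

(** * Moments of the standard normal law *)

Section GaussianMoments.
Variable R : realType.
Local Notation mu := (@lebesgue_measure R).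
Local Notation phi := (@normal_pdf R 0 1).
Implicit Types (x : R) (a k : nat).

Lemma standard_normal_pdfE x : phi x = normal_peak 1 * expR (- (x ^+ 2 / 2)).
Proof.
rewrite normal_pdfE ?oner_eq0 // /normal_fun subr0 expr1n.
by rewrite mulNr mulr2n.
Qed.

(** For [|x| <= 1] the exponential is at least 1; otherwise the power is raised to
[2 (a + 1)] and compared with one term of the exponential series. *)
Lemma normr_exprn_le a x :
  `|x| ^+ a <= (1 + 4 ^+ a.+1 * (a.+1)`!%:R) * expR (x ^+ 2 / 4).
Proof.
have y0 : 0 <= x ^+ 2 / 4 by rewrite mulr_ge0 ?sqr_ge0 ?invr_ge0.
have f0 : 0 < (a.+1)`!%:R :> R by rewrite ltr0n fact_gt0.
have e1 : 1 <= expR (x ^+ 2 / 4) by apply: le_trans (expR_ge1Dx _); rewrite lerDl.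
have big : `|x| ^+ (2 * a.+1) <= 4 ^+ a.+1 * (a.+1)`!%:R * expR (x ^+ 2 / 4).
  rewrite exprM -normrX ger0_norm ?sqr_ge0 //.
  have -> : (x ^+ 2) ^+ a.+1 =
      4 ^+ a.+1 * (a.+1)`!%:R * ((x ^+ 2 / 4) ^+ a.+1 / (a.+1)`!%:R).
    rewrite expr_div_n; field.
    by rewrite gt_eqF //= expf_neq0 // pnatr_eq0.
  rewrite ler_wpM2l ?mulr_ge0 ?exprn_ge0 //.
  by apply: le_trans (expR_ge1Dxn a y0); rewrite lerDr.
rewrite mulrDl mul1r; have [x1|x1] := leP `|x| 1.
  rewrite -[leLHS]addr0; apply: lerD.
    by apply: le_trans e1; rewrite exprn_ile1.
  by rewrite !mulr_ge0 ?exprn_ge0 ?expR_ge0.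
rewrite -[leLHS]add0r; apply: lerD; first exact: expR_ge0.
apply: le_trans big; rewrite ler_weXn2l //; [exact: ltW|lia].
Qed.

Definition moment_constant a : R :=
  (1 + 4 ^+ a.+1 * (a.+1)`!%:R) * normal_peak 1 / normal_peak (Num.sqrt 2).

Lemma moment_constant_ge0 a : 0 <= moment_constant a.
Proof.
rewrite /moment_constant divr_ge0 ?normal_peak_ge0 //.
by rewrite mulr_ge0 ?normal_peak_ge0 // addr_ge0 // mulr_ge0 // exprn_ge0.
Qed.

(** Half of the exponent absorbs the power and leaves the Gaussian density of
variance 2. *)
Lemma normr_exprn_pdf_le a x :
  `|x| ^+ a * phi x <= moment_constant a * normal_pdf 0 (Num.sqrt 2) x.
Proof.
have s2 : Num.sqrt 2 != 0 :> R by rewrite gt_eqF // sqrtr_gt0.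
rewrite standard_normal_pdfE normal_pdfE // /normal_fun subr0 sqr_sqrtr //.
have p2 : normal_peak (Num.sqrt 2) != 0 :> R by rewrite gt_eqF ?normal_peak_gt0.
have -> : moment_constant a *
   (normal_peak (Num.sqrt 2) * expR (- x ^+ 2 / (2 *+ 2))) =
   (1 + 4 ^+ a.+1 * (a.+1)`!%:R) * normal_peak 1 * expR (- x ^+ 2 / (2 *+ 2)).
  by rewrite /moment_constant -!mulrA; congr (_ * (_ * _)); rewrite mulKf.
have eE : expR (x ^+ 2 / 4) * expR (- (x ^+ 2 / 2)) = expR (- x ^+ 2 / (2 *+ 2)).
  by rewrite -expRD; congr expR; rewrite -mulr_natl; field.
rewrite -eE; have := normr_exprn_le a x; set A := `|x| ^+ a.
set B := 1 + _; set E1 := expR _; set E2 := expR _ => AB.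
have -> : B * normal_peak 1 * (E1 * E2) = B * E1 * (normal_peak 1 * E2) by ring.
by rewrite ler_wpM2r // mulr_ge0 ?normal_peak_ge0 ?expR_ge0.
Qed.

Lemma measurable_exprn_pdf a :
  measurable_fun setT (fun x : R => x ^+ a * phi x).
Proof.
apply: measurable_funM; last exact: measurable_normal_pdf.
by apply: measurable_funX; exact: measurable_id.
Qed.

Lemma integrable_exprn_pdf a :
  mu.-integrable setT (fun x => (x ^+ a * phi x)%:E).
Proof.
apply: (@le_integrable _ _ _ mu _ measurableT _
  (fun x => (moment_constant a)%:E * (normal_pdf 0 (Num.sqrt 2) x)%:E)%E).
- by apply/measurable_EFinP; exact: measurable_exprn_pdf.
- move=> x _; rewrite -EFinM !abse_EFin lee_fin [`|x ^+ a * _|]normrM normrX.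
  rewrite (ger0_norm (normal_pdf_ge0 _ _ _)).
  by apply: le_trans (normr_exprn_pdf_le a x) _; rewrite ler_norm.
- by apply: integrableZl => //; exact: integrable_normal_pdf.
Qed.

Definition gaussian_moment a : R := \int[mu]_x (x ^+ a * phi x).

Lemma gaussian_moment0 : gaussian_moment 0 = 1.
Proof.
rewrite /gaussian_moment /Rintegral; under eq_integral do rewrite expr0 mul1r.
by rewrite integral_normal_pdf.
Qed.

Lemma is_derive_exprn_pdf k x :
  is_derive x 1 (fun y : R => y ^+ k * phi y)
    (k%:R * (x ^+ k.-1 * phi x) - x ^+ k.+1 * phi x).
Proof.
have -> : (fun y : R => y ^+ k * phi y) =
    (fun y => normal_peak 1 * ((id ^+ k : R -> R) y * (expR \o (fun y => - (y ^+ 2 / 2))) y)).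
  by apply/funext => y; rewrite standard_normal_pdfE mulrCA exprfctE.
have dq : is_derive x (1 : R) (fun y : R => - (y ^+ 2 / 2)) (- x).
  have -> : (fun y : R => - (y ^+ 2 / 2)) = (fun y => - 2^-1 *: (id ^+ 2 : R -> R) y).
    by apply/funext => y; rewrite exprfctE scaleNr mulrC.
  by apply: is_derive_eq; rewrite expr1 /GRing.scale /= -mulr_natl; field.
apply: is_derive_eq.
rewrite standard_normal_pdfE exprfctE /GRing.scale /= [x ^+ k.+1]exprSr.
by ring.
Qed.

(** The product with [|s n| = n] is bounded, by the previous estimate for the
exponent [k + 1]. *)
Lemma exprn_pdf_cvg0 k (s : nat -> R) : (forall n, `|s n| = n%:R) ->
  (fun n => s n ^+ k * phi (s n)) @ \oo --> 0.
Proof.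
move=> sn; pose B := moment_constant k.+1 * normal_peak (Num.sqrt 2).
apply/norm_cvg0P.
apply: (@squeeze_cvgr _ _ _ _ (cst 0) (fun n => B * n%:R^-1)).
- near=> n; have n0 : (0 < n)%N by near: n; exists 1%N.
  have nR0 : 0 < n%:R :> R by rewrite ltr0n.
  rewrite /cst normr_ge0 /= ler_pdivlMr // normrM normrX sn.
  rewrite (ger0_norm (normal_pdf_ge0 _ _ _)) mulrC mulrA -exprS -sn.
  apply: le_trans (normr_exprn_pdf_le k.+1 (s n)) _.
  rewrite ler_wpM2l ?moment_constant_ge0 //; apply: normal_pdf_ub.
  by rewrite gt_eqF // sqrtr_gt0.
- exact: cvg_cst.
- rewrite -[X in _ --> X](mulr0 B).
  by apply: cvgM; [exact: cvg_cst|exact: cvg_natV].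
Unshelve. all: by end_near. Qed.

(** The integrand is the derivative of [x ^ k phi(x)]: integrate from [-n] to [n]
and let [n] tend to infinity. *)
Lemma integral_derive_exprn_pdf k :
  (\int[mu]_x (k%:R * (x ^+ k.-1 * phi x) - x ^+ k.+1 * phi x)%:E = 0)%E.
Proof.
set f := fun x : R => k%:R * (x ^+ k.-1 * phi x) - x ^+ k.+1 * phi x.
set G := fun x : R => x ^+ k * phi x.
have f_int : mu.-integrable setT (EFin \o f).
  apply: (@integrableB _ _ _ mu _ measurableT
    (fun x => (k%:R * (x ^+ k.-1 * phi x))%:E)
    (fun x => (x ^+ k.+1 * phi x)%:E)); last exact: integrable_exprn_pdf.
  exact: (integrableZl measurableT k%:R (integrable_exprn_pdf k.-1)).
have mf : measurable_fun setT (EFin \o f) := measurable_int _ f_int.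
pose fn n := (EFin \o f) \_ `[- n%:R, n%:R].
have mfn n : measurable_fun setT (fn n).
  by apply/(measurable_restrictT _ (measurable_itv _)); exact: measurable_funTS.
have fn_cvg : {ae mu, forall x, setT x -> fn ^~ x @ \oo --> (EFin \o f) x}.
  apply: aeW => x _; apply: cvg_near_cst.
  near=> n; rewrite /fn patchE mem_set //= in_itv /=.
  rewrite -ler_norml; near: n; exact: nbhs_infty_ger.
have f_abs : mu.-integrable setT (fun x => `|(EFin \o f) x|%E).
  exact: integrable_abse.
have fn_le : {ae mu, forall x n, setT x -> (`|fn n x| <= `|(EFin \o f) x|)%E}.
  apply: aeW => x n _; rewrite /fn patchE; case: ifP => _; first exact: lexx.
  by rewrite abse0 abse_ge0.
have [_ _ cvg_f] := @dominated_convergence _ (measurableTypeR R) R mu setT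
  measurableT fn (EFin \o f) _ mfn mf fn_cvg f_abs fn_le.
have int_fn : \forall n \near \oo,
    (G n%:R - G (- n%:R))%:E = (\int[mu]_x fn n x)%E.
  near=> n; rewrite -integral_mkcond EFinB; apply/esym.
  have n0 : (0 < n)%N by near: n; exists 1%N.
  apply: continuous_FTC2.
  - by rewrite -subr_gt0 opprK addr_gt0 ?ltr0n.
  - apply: continuous_subspaceT => x; apply: cvgB; apply: cvgM.
    + exact: cvg_cst.
    + apply: cvgM; first exact: exprn_continuous.
      by apply: continuous_normal_pdf; rewrite oner_eq0.
    + exact: exprn_continuous.
    + by apply: continuous_normal_pdf; rewrite oner_eq0.
  - have dG x : derivable G x 1 by have [] := is_derive_exprn_pdf k x.
    have cG : continuous G by move=> x; exact/differentiable_continuous/derivable1_diffP.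
    split; first by move=> x _.
      exact: cvg_at_right_filter (cG _).
    exact: cvg_at_left_filter (cG _).
  - by move=> x _; rewrite derive1E; have [_ ->] := is_derive_exprn_pdf k x.
have G0 : (fun n => (G n%:R - G (- n%:R))%:E) @ \oo --> 0%E.
  apply: cvg_EFin; first exact: nearW.
  rewrite -[X in _ --> X]subr0; apply: cvgB; apply: exprn_pdf_cvg0 => n.
    by rewrite normr_nat.
  by rewrite normrN normr_nat.
have int0 : (fun n => \int[mu]_x fn n x)%E @ \oo --> 0%E.
  by apply: cvg_trans (near_eq_cvg int_fn) G0.
exact: (cvg_unique (@ereal_hausdorff R) cvg_f int0).
Unshelve. all: by end_near. Qed.

Lemma gaussian_moment_rec k :
  gaussian_moment k.+1 = k%:R * gaussian_moment k.-1.
Proof.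
have := integral_derive_exprn_pdf k.
under eq_integral do rewrite EFinB EFinM.
have ik := integrable_exprn_pdf k.-1.
rewrite integralB //=; last 2 first.
- exact: integrableZl.
- exact: integrable_exprn_pdf.
rewrite integralZl // -(fineK (integrable_fin_num measurableT ik)).
rewrite -(fineK (integrable_fin_num measurableT (integrable_exprn_pdf k.+1))).
rewrite -EFinM -EFinB => -[/eqP].
by rewrite subr_eq0 => /eqP/esym.
Qed.

Lemma gaussian_moment1 : gaussian_moment 1 = 0.
Proof. by rewrite gaussian_moment_rec mul0r. Qed.

Lemma gaussian_momentSS a : gaussian_moment a.+2 = a.+1%:R * gaussian_moment a.
Proof. by rewrite gaussian_moment_rec. Qed.

End GaussianMoments.

(** * Integrals determined by indicators *)

(** If weighted integrals over [mu] of the indicators of [X] agree with the measure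
[nu], so do the integrals of nonnegative functions.  Used both to pass to a
density and to separate one independent variable from the others. *)
Section IntegralAgreement.
Local Open Scope ereal_scope.
Context d d' (T : measurableType d) (T' : measurableType d') (R : realType).
Variables (mu : {measure set T -> \bar R}) (nu : {measure set T' -> \bar R}).
Variables (X : T -> T') (Y : T -> R) (kappa : R).
Hypotheses (mX : measurable_fun setT X) (mY : measurable_fun setT Y).
Hypothesis Y_ge0 : forall w, (0 <= Y w)%R.
Hypothesis agree : forall A, measurable A ->
  \int[mu]_w ((Y w)%:E * (\1_A (X w))%:E) = kappa%:E * nu A.

Import HBNNSimple.

Lemma integral_agree_nnsfun (h : {nnsfun T' >-> R}) :
  \int[mu]_w ((Y w)%:E * (h (X w))%:E) = kappa%:E * \int[nu]_x (h x)%:E.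
Proof.
have ind_ge0 r x : 0 <= (r * \1_(h @^-1` [set r]) x)%:E.
  by rewrite EFinM nnfun_muleindic_ge0.
have mind r : measurable_fun setT (fun w => (\1_(h @^-1` [set r]) (X w) : R)).
  by apply: measurableT_comp mX; exact: measurable_indic.
have mYE : measurable_fun setT (EFin \o Y) by exact/measurable_EFinP.
rewrite integralT_nnsfun sintegralE ge0_mule_fsumr => [|r]; last first.
  exact: nnsfun_mulemu_ge0.
under eq_integral do rewrite fimfunE -fsumEFin // ge0_mule_fsumr //.
rewrite ge0_integral_fsum //; last 2 first.
- move=> r; apply: emeasurable_funM => //; apply/measurable_EFinP.
  exact: measurable_funM.
- by move=> r w _; apply: mule_ge0 => //; rewrite lee_fin.
apply: eq_fsbigr => r rh; have r0 : (0 <= r)%R.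
  by move: rh; rewrite inE => -[x _ <-].
under eq_integral do rewrite EFinM muleCA.
rewrite ge0_integralZl //; last 2 first.
- by apply: emeasurable_funM => //; exact/measurable_EFinP.
- by move=> w _; rewrite mule_ge0 // lee_fin.
by rewrite agree // muleCA.
Qed.

Lemma integral_agree (f : T' -> \bar R) : measurable_fun setT f ->
  (forall x, 0 <= f x) ->
  \int[mu]_w ((Y w)%:E * f (X w)) = kappa%:E * \int[nu]_x f x.
Proof.
move=> mf f0; pose h := nnsfun_approx measurableT mf.
have h_cvg x : EFin \o h^~ x @ \oo --> f x by exact: cvg_nnsfun_approx.
have h_nd x : {homo (fun n => (h n x)%:E) : m n / (m <= n)%N >-> m <= n}.
  by move=> m n mn; rewrite lee_fin; exact/lefP/nd_nnsfun_approx.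
have left : (fun n => \int[mu]_w ((Y w)%:E * (h n (X w))%:E)) @ \oo -->
    \int[mu]_w ((Y w)%:E * f (X w)).
  have -> : \int[mu]_w ((Y w)%:E * f (X w)) =
      \int[mu]_w limn (fun n => (Y w)%:E * (h n (X w))%:E).
    apply: eq_integral => w _; apply/esym/cvg_lim => //.
    by apply: cvgeZl => //; exact: h_cvg.
  apply: cvg_monotone_convergence => //.
  - move=> n; apply: emeasurable_funM; apply/measurable_EFinP => //.
    by apply: measurableT_comp mX.
  - by move=> n w _; rewrite mule_ge0 // lee_fin.
  - by move=> w _ m n mn; apply: lee_wpmul2l; [rewrite lee_fin|exact: h_nd].
have right : (fun n => kappa%:E * \int[nu]_x (h n x)%:E) @ \oo -->
    kappa%:E * \int[nu]_x f x.
  apply: cvgeZl => //.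
  have -> : \int[nu]_x f x = \int[nu]_x limn (fun n => (h n x)%:E).
    by apply: eq_integral => x _; apply/esym/cvg_lim => //; exact: h_cvg.
  apply: cvg_monotone_convergence => //.
  - by move=> n; exact/measurable_EFinP.
  - by move=> n x _; rewrite lee_fin.
have stepE : (fun n => \int[mu]_w ((Y w)%:E * (h n (X w))%:E)) =
    (fun n => kappa%:E * \int[nu]_x (h n x)%:E).
  by apply/funext => n; exact: integral_agree_nnsfun.
rewrite stepE in left; exact: (cvg_unique (@ereal_hausdorff R) left right).
Qed.

End IntegralAgreement.

(** * Products of independent random variables *)

Section IndependentProducts.
Context d (T : measurableType d) (R : realType) (P : probability T R).
Variables (I : finType) (X : I -> {RV P >-> R}).
Hypothesis X_indep : mutually_independent X.

Local Notation mean f := (fine (\int[P]_w (f w)%:E)%E).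

Lemma prod_EFin (J : Type) (r : seq J) (p : pred J) (F : J -> R) :
  (\prod_(i <- r | p i) (F i)%:E = (\prod_(i <- r | p i) F i)%:E)%E.
Proof. by apply: (big_ind2 (fun x y => x = y%:E)) => // x y x' y' -> ->. Qed.

Lemma measurable_prod_RV (r : seq I) (p : pred I) (g : I -> R -> R) :
  (forall i, measurable_fun setT (g i)) ->
  measurable_fun setT (fun w => \prod_(i <- r | p i) g i (X i w)).
Proof.
move=> mg; under eq_fun do rewrite -big_filter.
by apply: measurable_prod => i _; apply: measurableT_comp => //; exact: mg.
Qed.

Lemma measurable_RV_preimage i A : measurable A -> measurable (X i @^-1` A).
Proof. by move=> mA; rewrite -[X in measurable X]setTI; exact: measurable_funP. Qed.

Lemma mean_indic_RV i A : measurable A ->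
  (\int[P]_w (\1_A (X i w))%:E = P (X i @^-1` A))%E.
Proof.
move=> mA; have mXA := measurable_RV_preimage i mA.
by have := integral_indic P measurableT mXA; rewrite setIT => <-.
Qed.

Lemma mean_prod_indic (A : I -> set R) : (forall i, measurable (A i)) ->
  (\int[P]_w (\prod_i (\1_(A i) (X i w) : R))%:E =
   (\prod_i mean (fun w => \1_(A i) (X i w)))%:E)%E.
Proof.
move=> mA; pose C := \bigcap_(i in [set` [set: I]%SET]) (X i @^-1` A i).
have mC : measurable C.
  by apply: fin_bigcap_measurable => // i _; exact: measurable_RV_preimage.
have -> : (\int[P]_w (\prod_i (\1_(A i) (X i w) : R))%:E = P C)%E.
  transitivity (\int[P]_w (\1_C w)%:E)%E; last by rewrite integral_indic // setIT.
  apply: eq_integral => w _; congr (_%:E).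
  rewrite indicE; case: (boolP (w \in C)) => [/set_mem wC|wC].
    rewrite big1 // => i _; rewrite indicE mem_set //.
    by apply: wC; rewrite /= inE.
  have [i wi] : exists i, ~ A i (X i w).
    apply: contra_notP (negP wC) => /forallNP wA; apply/mem_set => i _.
    by apply: contrapT; exact: wA.
  by rewrite (bigD1 i) //= indicE memNset // mul0r.
rewrite X_indep // -prod_EFin; apply: eq_big => [i|i _]; first by rewrite finset.in_setT.
rewrite mean_indic_RV // fineK // fin_num_measure //.
exact: measurable_RV_preimage.
Qed.

(** The functions are replaced one at a time, starting from indicators, for which
the claim is independence.  When all but one are fixed, the product of the
fixed ones is the weight in [integral_agree]. *)
Lemma mean_prod_ge0 (g : I -> R -> R) :
  (forall i, measurable_fun setT (g i)) -> (forall i x, 0 <= g i x) ->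
  (forall i, (\int[P]_w (g i (X i w))%:E < +oo)%E) ->
  (\int[P]_w (\prod_i g i (X i w))%:E =
   (\prod_i mean (fun w => g i (X i w)))%:E)%E.
Proof.
move=> mg g0 gfin.
have : forall i, i \notin enum I -> exists2 A, measurable A & g i = \1_A.
  by move=> i; rewrite mem_enum.
(* Outside the list of indices on which the induction runs, all functions are
   indicators. *)
elim: (enum I) g mg g0 gfin => [|i s IHs] g mg g0 gfin gind.
  have /choice[A hA] : forall i, exists A, measurable A /\ g i = \1_A.
    by move=> i; have [A mA gA] := gind i isT; exists A.
  have -> : g = (fun i => \1_(A i)) by apply/funext => i; rewrite (hA i).2.
  by apply: mean_prod_indic => i; exact: (hA i).1.
pose Y w := \prod_(j | j != i) g j (X j w).
pose kappa := \prod_(j | j != i) mean (fun w => g j (X j w)).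
have Y0 w : 0 <= Y w by apply: prodr_ge0 => j _.
have mY : measurable_fun setT Y by exact: measurable_prod_RV.
have agree A : measurable A ->
    (\int[P]_w ((Y w)%:E * (\1_A (X i w))%:E) = kappa%:E * distribution P (X i) A)%E.
  move=> mA; pose g' j := if j == i then \1_A else g j.
  have intA := mean_indic_RV i mA.
  have g'i : g' i = \1_A by rewrite /g' eqxx.
  have g'j j : j != i -> g' j = g j by rewrite /g' => /negbTE ->.
  have E : (\int[P]_w (\prod_j g' j (X j w))%:E =
      (\prod_j mean (fun w => g' j (X j w)))%:E)%E.
    apply: IHs => j.
    - by rewrite /g'; case: ifP => // _; exact: measurable_indic.
    - by move=> x; rewrite /g'; case: ifP.
    - rewrite /g'; case: ifP => // /eqP ->; rewrite intA.
      apply: le_lt_trans (ltry 1); apply: probability_le1.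
      exact: measurable_RV_preimage.
    - move=> js; have [->|ji] := eqVneq j i; first by rewrite g'i; exists A.
      by rewrite g'j //; apply: gind; rewrite inE (negbTE ji).
  transitivity (\int[P]_w (\prod_j g' j (X j w))%:E)%E.
    apply: eq_integral => w _; rewrite (bigD1 i) //= g'i mulrC EFinM.
    by congr (_%:E * _)%E; apply: eq_bigr => j /g'j ->.
  rewrite E (bigD1 i) //= g'i intA mulrC EFinM fineK; last first.
    by rewrite fin_num_measure //; exact: measurable_RV_preimage.
  by congr (_%:E * _)%E; apply: eq_bigr => j /g'j ->.
have := integral_agree (X := X i) _ mY Y0 agree (f := EFin \o g i).
rewrite ge0_integral_distribution //=; last 2 first.
- exact/measurable_EFinP.
- by move=> x; rewrite lee_fin.
have -> : (fun w => (Y w)%:E * (g i (X i w))%:E)%E =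
    (fun w => (\prod_j g j (X j w))%:E).
  by apply/funext => w; rewrite (bigD1 i) //= mulrC EFinM.
move=> -> //; last 2 first.
- exact/measurable_EFinP.
- by move=> x; rewrite lee_fin.
rewrite [in RHS](bigD1 i) //= mulrC EFinM fineK //.
rewrite ge0_fin_numE //; apply: integral_ge0 => w _; rewrite lee_fin //.
Qed.

Lemma RV_integrableP (h : T -> R) : measurable_fun setT h ->
  (\int[P]_w `|h w|%:E < +oo)%E -> P.-integrable setT (EFin \o h).
Proof. by move=> mh hfin; apply/integrableP; split; first exact/measurable_EFinP. Qed.

Lemma mean_sum (J : Type) (r : seq J) (h : J -> T -> R) :
  (forall j, P.-integrable setT (EFin \o h j)) ->
  P.-integrable setT (EFin \o (fun w => \sum_(j <- r) h j w)) /\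
  \int[P]_w (\sum_(j <- r) h j w) = \sum_(j <- r) \int[P]_w h j w.
Proof.
move=> hI; elim: r => [|j r [IHr1 IHr2]].
  have -> : (fun w => \sum_(j <- [::]) h j w) = cst 0.
    by apply/funext => w; rewrite big_nil.
  split; last by rewrite big_nil Rintegral_cst // mul0r.
  exact: (finite_measure_integrable_cst P 0 measurableT).
have -> : (fun w => \sum_(i <- j :: r) h i w) =
    (fun w => h j w + \sum_(i <- r) h i w).
  by apply/funext => w; rewrite big_cons.
split; last by rewrite big_cons RintegralD // IHr2.
by have := integrableD measurableT (hI j) IHr1.
Qed.

(** Each function is split into positive and negative parts, the product is
expanded, and [mean_prod_ge0] applies to every term. *)
Lemma mean_prod (f : I -> R -> R) :
  (forall i, measurable_fun setT (f i)) ->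
  (forall i, P.-integrable setT (EFin \o (fun w => f i (X i w)))) ->
  P.-integrable setT (EFin \o (fun w => \prod_i f i (X i w))) /\
  \int[P]_w (\prod_i f i (X i w)) = \prod_i \int[P]_w f i (X i w).
Proof.
move=> mf fI.
pose s (b : bool) : R := if b then 1 else -1.
pose g b i x : R := Num.max (s b * f i x) 0.
have g0 b i x : 0 <= g b i x by rewrite le_max lexx orbT.
have mg b i : measurable_fun setT (g b i).
  by apply: measurable_maxr; [apply: measurable_funM|exact: measurable_cst].
(* [g true] and [g false] are the positive and negative parts. *)
have fE i x : f i x = s true * g true i x + s false * g false i x.
  rewrite /g /s !mul1r !mulN1r; case: (boolP (0 <= f i x)) => [f0|].
    by rewrite max_l // max_r ?oppr_le0 // subr0.
  rewrite -ltNge => /ltW f0.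
  by rewrite max_r // max_l ?opprK ?add0r // oppr_ge0.
have gI b i : P.-integrable setT (EFin \o (fun w => g b i (X i w))).
  apply: le_integrable (fI i) => //.
    by apply/measurable_EFinP; apply: measurableT_comp => //; exact: mg.
  move=> w _ /=; rewrite lee_fin ger0_norm //.
  rewrite ge_max normr_ge0 andbT; apply: le_trans (ler_norm _) _.
  by rewrite normrM /s; case: b; rewrite ?normrN1 ?normr1 mul1r.
have gfin b i : (\int[P]_w (g b i (X i w))%:E < +oo)%E.
  have /integrableP[_] := gI b i; apply: le_lt_trans.
  by rewrite le_eqVlt; apply/orP; left; apply/eqP; apply: eq_integral => w _;
    rewrite /= ger0_norm.
pose h (e : {ffun I -> bool}) w :=
  (\prod_i s (e i)) * \prod_i g (e i) i (X i w).
have prod_expand (a : bool -> I -> R) :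
    \prod_i (s true * a true i + s false * a false i) =
    \sum_(e : {ffun I -> bool}) (\prod_i s (e i)) * \prod_i a (e i) i.
  under eq_bigr do rewrite -(big_bool _ (fun b => s b * a b _)).
  by rewrite bigA_distr_bigA; apply: eq_bigr => e _; rewrite -big_split.
have hE : (fun w => \prod_i f i (X i w)) = (fun w => \sum_e h e w).
  apply/funext => w; under eq_bigr do rewrite fE.
  exact: (prod_expand (fun b i => g b i (X i w))).
have prodI (e : {ffun I -> bool}) :
    P.-integrable setT (EFin \o (fun w => \prod_i g (e i) i (X i w))).
  apply: RV_integrableP; first
    by apply: (@measurable_prod_RV _ _ (fun i => g (e i) i)).
  under eq_integral do rewrite ger0_norm ?prodr_ge0 //.
  by rewrite (@mean_prod_ge0 (fun i => g (e i) i)) // ltry.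
have hI e : P.-integrable setT (EFin \o h e).
  by have := integrableZl measurableT (\prod_i s (e i)) (prodI e).
have [sumI sumE] := mean_sum (index_enum _) hI.
rewrite hE; split=> //; rewrite sumE.
have -> : \prod_i \int[P]_w f i (X i w) =
    \prod_i (s true * \int[P]_w g true i (X i w)
             + s false * \int[P]_w g false i (X i w)).
  apply: eq_bigr => i _; under eq_Rintegral do rewrite fE.
  have sgI b := integrableZl measurableT (s b) (gI b i).
  rewrite (@RintegralD _ _ _ P _ (fun w => s true * g true i (X i w))
    (fun w => s false * g false i (X i w)) measurableT (sgI true) (sgI false)).
  by rewrite !(RintegralZl _ measurableT (gI _ i)).
rewrite (prod_expand (fun b i => \int[P]_w g b i (X i w))).
apply: eq_bigr => e _; rewrite RintegralZl //; congr (_ * _).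
by rewrite /Rintegral (@mean_prod_ge0 (fun i => g (e i) i)).
Qed.

End IndependentProducts.

(** * Standard normal random variables *)

Section StandardNormalMoments.
Context d (T : measurableType d) (R : realType) (P : probability T R).
Variable X : {RV P >-> R}.
Hypothesis X_normal : standard_normal X.

Local Notation mu := (@lebesgue_measure R).
Local Notation phi := (@normal_pdf R 0 1).

Lemma standard_normal_integral (f : R -> R) :
  measurable_fun setT f -> (forall x, 0 <= f x) ->
  (\int[P]_w (f (X w))%:E = \int[mu]_x (f x * phi x)%:E)%E.
Proof.
move=> mf f0; have mfE : measurable_fun setT (EFin \o f) by exact/measurable_EFinP.
have fE0 x : (0 <= (EFin \o f) x)%E by rewrite lee_fin.
rewrite -[LHS](ge0_integral_distribution X mfE fE0).
have agree A : measurable A ->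
    (\int[mu]_x ((phi x)%:E * (\1_A (id x))%:E) = 1%:E * distribution P X A)%E.
  move=> mA; rewrite mul1e X_normal // /normal_prob.
  by rewrite [RHS]integral_mkcond epatch_indic.
have mid : measurable_fun setT (@id R) by exact: measurable_id.
have := @integral_agree _ _ (measurableTypeR R) _ R mu (distribution P X) id phi 1
  mid (measurable_normal_pdf 0 1) (normal_pdf_ge0 0 1) agree _ mfE fE0.
rewrite mul1e => <-; apply: eq_integral => x _.
by rewrite mulrC EFinM.
Qed.

Lemma integrable_standard_normal_exprn a :
  P.-integrable setT (EFin \o (fun w => X w ^+ a)).
Proof.
have mX : measurable_fun setT (fun w => X w ^+ a) by apply: measurable_funX.
apply/integrableP; split; first exact/measurable_EFinP.
rewrite (standard_normal_integral (f := fun x => `|x ^+ a|)) //; last first.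
  by apply: measurableT_comp => //; apply: measurable_funX; exact: measurable_id.
have /integrableP[_] := integrable_exprn_pdf R a; apply: le_lt_trans.
rewrite le_eqVlt; apply/orP; left; apply/eqP; apply: eq_integral => x _.
by rewrite /= normrM (ger0_norm (normal_pdf_ge0 _ _ _)).
Qed.

(** Nonnegative functions are covered by [standard_normal_integral]; the power is
the difference of [x ^ a + |x ^ a|] and [|x ^ a|]. *)
Lemma standard_normal_moment a : \int[P]_w (X w ^+ a) = gaussian_moment R a.
Proof.
have IP := integrable_standard_normal_exprn a.
have Imu := integrable_exprn_pdf R a.
have IPa := integrable_norm IP; have Imua := integrable_norm Imu.
have absE : \int[P]_w `|X w ^+ a| = \int[mu]_x `|x ^+ a * phi x|.
  rewrite /Rintegral (standard_normal_integral (f := fun x => `|x ^+ a|)) //.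
    congr fine; apply: eq_integral => x _.
    by rewrite normrM (ger0_norm (normal_pdf_ge0 _ _ _)).
  by apply: measurableT_comp => //; apply: measurable_funX; exact: measurable_id.
have sumE : \int[P]_w (X w ^+ a + `|X w ^+ a|) =
    \int[mu]_x (x ^+ a * phi x + `|x ^+ a * phi x|).
  rewrite /Rintegral (standard_normal_integral (f := fun x => x ^+ a + `|x ^+ a|)).
  - congr fine; apply: eq_integral => x _.
    by rewrite normrM (ger0_norm (normal_pdf_ge0 _ _ _)) -mulrDl.
  - apply: measurable_funD; last apply: measurableT_comp => //;
    by apply: measurable_funX; exact: measurable_id.
  - by move=> x; have := ler_norm (- x ^+ a); rewrite normrN -subr_ge0 opprK addrC.
rewrite (@RintegralD _ _ _ P _ _ _ measurableT IP IPa) in sumE.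
rewrite (@RintegralD _ _ _ mu _ _ _ measurableT Imu Imua) in sumE.
by move: sumE; rewrite absE => /addIr.
Qed.

End StandardNormalMoments.

(** * Trace moments of Wishart matrices *)

Section WishartMoments.
Context d (T : measurableType d) (R : realType) (P : probability T R).
Variables (N M : nat) (G : 'I_N * 'I_M -> {RV P >-> R}).
Hypotheses (N_gt0 : (0 < N)%N) (G_iid : iid_standard_normal G).

Definition entry_index (k : 'I_(N * M)) : 'I_N * 'I_M :=
  enum_val (cast_ord (esym (mxvec_cast N M)) k).

Lemma entry_indexK i j : entry_index (mxvec_index i j) = (i, j).
Proof. by rewrite /entry_index cast_ordK enum_rankK. Qed.

Definition sample (w : T) (k : 'I_(N * M)) : R := G (entry_index k) w.

Definition gaussian_mean (p : mpoly (N * M) R) : R :=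
  \int[P]_w meval (sample w) p.

Lemma prod_entry (F : 'I_(N * M) -> R) :
  \prod_k F k = \prod_(ij : 'I_N * 'I_M) F (mxvec_index ij.1 ij.2).
Proof.
rewrite (reindex _ (curry_mxvec_bij N M)) /=.
by apply: eq_bigr => -[i j].
Qed.

Lemma monomial_mean (m : multinom (N * M)) :
  P.-integrable setT (EFin \o (fun w => \prod_k sample w k ^+ m k)) /\
  \int[P]_w (\prod_k sample w k ^+ m k) = \prod_k gaussian_moment R (m k).
Proof.
have [G_normal G_indep] := G_iid.
pose f (ij : 'I_N * 'I_M) x : R := x ^+ m (mxvec_index ij.1 ij.2).
have -> : (fun w => \prod_k sample w k ^+ m k) = (fun w => \prod_ij f ij (G ij w)).
  apply/funext => w; rewrite prod_entry; apply: eq_bigr => -[i j] _.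
  by rewrite /sample entry_indexK.
have mf ij : measurable_fun setT (f ij).
  by apply: measurable_funX; exact: measurable_id.
have fI ij : P.-integrable setT (EFin \o (fun w => f ij (G ij w))).
  exact: integrable_standard_normal_exprn (G_normal ij) _.
have [pI pE] := mean_prod G_indep mf fI; split=> //.
rewrite pE prod_entry; apply: eq_bigr => ij _.
exact: standard_normal_moment (G_normal ij) _.
Qed.

Lemma meval_integrable (p : mpoly (N * M) R) :
  P.-integrable setT (EFin \o (fun w => meval (sample w) p)).
Proof.
have -> : (fun w => meval (sample w) p) =
    (fun w => \sum_(m <- msupp p) mcoeff m p * \prod_k sample w k ^+ m k).
  by apply/funext => w; rewrite mevalE.
apply: (proj1 (mean_sum _ _)) => m.
exact: (integrableZl measurableT (mcoeff m p) (proj1 (monomial_mean m))).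
Qed.

Lemma gaussian_mean_linear : linear_for *%R gaussian_mean.
Proof.
move=> a p q; rewrite /gaussian_mean.
under eq_Rintegral do rewrite mevalD mevalZ.
have ap := integrableZl measurableT a (meval_integrable p).
rewrite (@RintegralD _ _ _ P _ (fun w => a * meval (sample w) p) _ measurableT ap
  (meval_integrable q)).
by rewrite (RintegralZl _ measurableT (meval_integrable p)).
Qed.

HB.instance Definition _ := GRing.isLinear.Build R (mpoly (N * M) R) R *%R
  gaussian_mean gaussian_mean_linear.

Lemma gaussian_mean_monomial m :
  gaussian_mean (mpolyX R m) = \prod_k gaussian_moment R (m k).
Proof.
rewrite -(proj2 (monomial_mean m)) /gaussian_mean.
by apply: eq_Rintegral => w _; rewrite mevalX.
Qed.

(** The sequence of exponents is the list [s] of the loop equations. *)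
Definition mixed_moment (s : seq nat) : R :=
  \int[P]_w \prod_(l <- s) ntr (wishart G w ^+ l).

Lemma exprZ_mx n (a : R) (B : 'M[R]_N) : (a *: B) ^+ n = a ^+ n *: B ^+ n.
Proof.
elim: n => [|n IHn]; first by rewrite !expr0 scale1r.
by rewrite !exprS IHn -!mulmxE -scalemxAl -scalemxAr scalerA.
Qed.

Lemma map_mx_exprn (A : pzRingType) (f : {rmorphism A -> R}) (B : 'M[A]_N) n :
  map_mx f (B ^+ n) = map_mx f B ^+ n.
Proof.
elim: n => [|n IHn]; first by rewrite !expr0 map_mx1.
by rewrite !exprS -!mulmxE map_mxM IHn.
Qed.

Lemma meval_generic_trace w l :
  let W := generic_matrix R N M *m (generic_matrix R N M)^T in
  meval (sample w) (\tr (W ^+ l)) = N%:R ^+ l.+1 * ntr (wishart G w ^+ l).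
Proof.
move=> W; have N0 : N%:R != 0 :> R by rewrite pnatr_eq0 -lt0n.
rewrite -trace_map_mx map_mx_exprn /W map_mxM -map_trmx.
have -> : map_mx (meval (sample w)) (generic_matrix R N M) =
    \matrix_(i < N, j < M) G (i, j) w.
  by apply/matrixP => i j; rewrite !mxE mevalXU /sample entry_indexK.
rewrite /ntr /wishart exprZ_mx mxtraceZ exprS.
by rewrite exprVn; field; rewrite N0 expf_neq0.
Qed.

Lemma mixed_momentE s :
  mixed_moment s = trace_moment gaussian_mean (generic_matrix R N M) s.
Proof.
have N0 : N%:R != 0 :> R by rewrite pnatr_eq0 -lt0n.
have prodE w : \prod_(l <- s) ntr (wishart G w ^+ l) =
    meval (sample w) (trace_prod (generic_matrix R N M) s)
    * (N%:R ^+ (size s + sumn s))^-1.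
  rewrite /trace_prod rmorph_prod /=.
  elim: s => [|l s IHs] /=; first by rewrite !big_nil expr0 invr1 mulr1.
  rewrite !big_cons IHs meval_generic_trace.
  have -> : ((size s).+1 + (l + sumn s) = l.+1 + (size s + sumn s))%N by lia.
  rewrite (exprD _ l.+1); move: (N%:R ^+ l.+1) (expf_neq0 l.+1 N0) => x x0.
  move: (N%:R ^+ _) (expf_neq0 (size s + sumn s) N0) => y y0.
  by field; rewrite x0 y0.
rewrite /mixed_moment /trace_moment /= /gaussian_mean.
under eq_Rintegral do rewrite prodE.
by rewrite RintegralZr //; exact: meval_integrable.
Qed.

Lemma mixed_moment_nil : mixed_moment [::] = 1.
Proof.
have N0 : N%:R != 0 :> R by rewrite pnatr_eq0 -lt0n.
rewrite mixed_momentE trace_moment_nil //=.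
by rewrite (gaussian_functional1 gaussian_mean_monomial) // gaussian_moment0.
Qed.

Lemma mixed_moment_0 s : mixed_moment (0%N :: s) = mixed_moment s.
Proof.
have N0 : N%:R != 0 :> R by rewrite pnatr_eq0 -lt0n.
by rewrite !mixed_momentE trace_moment_0.
Qed.

Lemma mixed_moment_S n s : mixed_moment (n.+1 :: s) =
  M%:R / N%:R * mixed_moment (n :: s)
  + \sum_(k < n) mixed_moment [:: k : nat, (n - k)%N & s]
  + n%:R / N%:R * mixed_moment (n :: s)
  + N%:R ^- 2 * \sum_(cs <- merges n s) cs.1%:R * mixed_moment cs.2.
Proof.
have N0 : N%:R != 0 :> R by rewrite pnatr_eq0 -lt0n.
rewrite !mixed_momentE (generic_trace_moment_S gaussian_mean_monomial) //.
- congr (_ + _ + _ + _); first by apply: eq_bigr => k _; rewrite mixed_momentE.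
  by congr (_ * _); apply: eq_bigr => cs _; rewrite mixed_momentE.
- exact: gaussian_moment1.
- exact: gaussian_momentSS.
Qed.

Lemma expectation_ntr n :
  fine 'E_P[fun w => ntr (wishart G w ^+ n)] = mixed_moment [:: n].
Proof.
rewrite unlock /mixed_moment /Rintegral; congr fine.
by apply: eq_integral => w _; rewrite big_seq1.
Qed.

End WishartMoments.

(** * The generating function over the complex numbers *)

Section ComplexSeries.
Variable R : realType.
Local Notation C := R[i].

Lemma normc_real (x : R) : `|x%:C| = `|x|%:C :> C.
Proof. by rewrite normc_def /= expr0n addr0 sqrtr_sqr. Qed.

(** The bound is a complex number, but a nonnegative one, so the statement reduces
to a real geometric sequence. *)
Lemma geo_null_cvg (f : nat -> C) (l : C) :
  geo_null (fun N => f N - l) -> (f : nat -> C^o) @ \oo --> (l : C^o).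
Proof.
move=> [B hB]; apply/cvgrPdist_lt => eps eps0.
have B0 : 0 <= B.
  by have := hB 0%N; rewrite expr0 mulr1; exact: le_trans (normr_ge0 _).
have BE : (complex.Re B)%:C = B by rewrite RRe_real // ger0_real.
have epsE : (complex.Re eps)%:C = eps by rewrite RRe_real // gtr0_real.
have /cvgr0Pnorm_lt : geometric (complex.Re B) (2^-1 : R) @ \oo --> 0.
  apply: cvg_geometric; rewrite ger0_norm ?invr_ge0 //.
  by rewrite invf_lt1 // ltr1n.
move=> /(_ (complex.Re eps)); rewrite -ltcR epsE => /(_ eps0).
apply: filterS => N; rewrite -ltcR epsE -normc_real distrC; apply: le_lt_trans.
apply: le_trans (hB N) _; rewrite /geometric /= rmorphM rmorphXn /=.
rewrite rmorphV ?unitfE ?pnatr_eq0 //= rmorph_nat BE.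
by rewrite ger0_norm // mulr_ge0 ?exprn_ge0 ?invr_ge0.
Qed.

Variables (c c' : R).
Hypothesis c_gt0 : 0 < c.
Local Notation m := (planar_moment c 0).
Local Notation h := (linearized_moment c c').
Local Notation L := (growth_rate c c').

Lemma geo_bounded_real (a : nat -> R) (B : R) :
  (forall n, `|a n| <= B * L ^+ n) -> forall n, `|(a n)%:C| <= B%:C * L%:C ^+ n.
Proof. by move=> aB n; rewrite normc_real -rmorphXn -rmorphM lecR. Qed.

Lemma complex_planar_momentS n :
  (m n.+1)%:C = c%:C * (m n)%:C + convol (fun k => (m k)%:C) (fun k => (m k)%:C) n.
Proof.
rewrite planar_momentS mulr0 mul0r addr0 rmorphD rmorphM rmorph_sum /=.
by congr (_ + _); apply: eq_bigr => k _; rewrite rmorphM.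
Qed.

Lemma complex_linearized_momentS n : (h n.+1)%:C =
  c'%:C * (m n)%:C + c%:C * (h n)%:C
  + (convol (fun k => (h k)%:C) (fun k => (m k)%:C) n
     + convol (fun k => (m k)%:C) (fun k => (h k)%:C) n) + n%:R * (m n)%:C.
Proof.
rewrite linearized_momentS !rmorphD !rmorphM rmorph_nat rmorph_sum /=.
congr (_ + _ + _); rewrite -big_split /=; apply: eq_bigr => k _.
by rewrite rmorphD !rmorphM.
Qed.

Lemma sqrt_branch_endpoints :
  ((1 - Num.sqrt c) ^+ 2 + (1 + Num.sqrt c) ^+ 2 = 2 * (1 + c)) *
  ((1 - Num.sqrt c) ^+ 2 * (1 + Num.sqrt c) ^+ 2 = (1 - c) ^+ 2).
Proof.
have cE := sqr_sqrtr (ltW c_gt0); set s := Num.sqrt c in cE *.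
by rewrite -cE; split; ring.
Qed.

(** The radius ensures at once that [u = 1 / z] is within the range of the
partial sum estimates, that [z] is off the cut, and that [S / z] is close
enough to 1 to tell [S] from [- S]. *)
Lemma linearized_generating_function (sqrtP : C^o -> C^o) :
  let a := (1 - Num.sqrt c) ^+ 2 in
  let b := (1 + Num.sqrt c) ^+ 2 in
  is_sqrt_branch a b sqrtP ->
  exists r : R, forall z : C, r%:C < `|z| ->
    (series (fun n : nat => (h n)%:C / z ^+ n.+1) : nat -> C^o) @ \oo -->
    ((- c'%:C / (z * sqrtP z)
       * (((1 - c%:C) ^+ 2 - (1 + c%:C) * z - (1 - c%:C) * sqrtP z)
          / (sqrtP z + z - 1 + c%:C))
     + 2^-1 * (2^-1 * ((z - a%:C)^-1 + (z - b%:C)^-1) - (sqrtP z)^-1))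
     : C^o).
Proof.
move=> a b [_ sqrt_sqr sqrt_near].
have [r0 hr0] := sqrt_near 2^-1 ltac:(by rewrite invr_gt0).
have L0 : 0 < L := growth_rate_gt0 c' c_gt0.
have a0 : 0 <= a := sqr_ge0 _.
have b0 : 0 <= b := sqr_ge0 _.
pose r1 := 2 * (`|1 - c| + 2 * 4).
(* [r0] controls [S / z], [8 * L] the growth of the coefficients and [b] the cut;
   [r1] separates [S] from [- S]. *)
exists (`|r0| + 8 * L + b + r1) => z zr.
have r1_ge0 : 0 <= r1 by rewrite !mulr_ge0 ?addr_ge0 ?mulr_ge0.
have large (x : R) : x <= `|r0| + 8 * L + b + r1 -> x%:C < `|z|.
  by move=> xr; apply: le_lt_trans zr; rewrite lecR.
have z_r0 := large r0 ltac:(have := ler_norm r0; lra).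
have z_L := large (8 * L) ltac:(have := normr_ge0 r0; lra).
have z_b := large b ltac:(have := normr_ge0 r0; lra).
have z_r1 := large r1 ltac:(have := normr_ge0 r0; lra).
have z_gt0 : 0 < `|z| by apply: le_lt_trans z_b; rewrite lecR.
have z0 : z != 0 by rewrite -normr_gt0.
set S := sqrtP z.
have S_near : `|S / z - 1| <= 2^-1.
  have := ltW (hr0 z z_r0); rewrite rmorphV ?unitfE ?pnatr_eq0 //=.
  by rewrite rmorph_nat.
have abC : (a%:C + b%:C = 2 * (1 + c%:C)) * (a%:C * b%:C = (1 - c%:C) ^+ 2).
  have [ab1 ab2] := sqrt_branch_endpoints.
  split; first by rewrite -rmorphD ab1 rmorphM rmorph_nat rmorphD rmorph1.
  by rewrite -rmorphM ab2 rmorphXn rmorphB rmorph1.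
have S_sqr : S ^+ 2 = z ^+ 2 - 2 * (1 + c%:C) * z + (1 - c%:C) ^+ 2.
  rewrite /S sqrt_sqr => [|[t /andP[at_ tb] zt]].
    by rewrite -abC.1 -abC.2; ring.
  move: z_b; rewrite zt normc_real ltcR ger0_norm ?(le_trans a0) //.
  by rewrite ltNge tb.
have L_ge0 : 0 <= L%:C :> C by rewrite lecR ltW.
have uL : `|z^-1| * L%:C <= 8^-1.
  rewrite normfV mulrC ler_pdivrMr // mulrC ler_pdivlMr //.
  by rewrite -(rmorph_nat (real_complex R)) mulrC -rmorphM ltW.
have mB : forall n, `|(m n)%:C| <= 2%:C * L%:C ^+ n.
  apply: geo_bounded_real => n.
  by rewrite ger0_norm ?planar_moment_geo ?planar_moment_ge0.
have dB : forall n, `|n%:R * (m n)%:C| <= 2%:C * L%:C ^+ n.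
  have dB0 n : `|n%:R * m n| <= 2 * L ^+ n.
    by rewrite ger0_norm ?planar_derivative_geo // mulr_ge0 ?planar_moment_ge0.
  by move=> n; have := geo_bounded_real dB0 n; rewrite rmorphM rmorph_nat.
have hB : forall n, `|(h n)%:C| <= 1%:C * L%:C ^+ n.
  by apply: geo_bounded_real => n; rewrite mul1r; exact: linearized_moment_geo.
have MB N : `|psum z^-1 (fun n => (m n)%:C) N| <= 4.
  apply: le_trans (psum_le L_ge0 uL N mB) _.
  by rewrite rmorph_nat -natrM.
have z_r1' : 2 * (`|1 - c%:C| + 2 * 4) <= `|z|.
  apply: (le_trans _ (ltW z_r1)).
  have dbl (x : R) : (2 * x)%:C = 2 * x%:C :> C by rewrite !mulr_natl rmorphMn.
  rewrite /r1 dbl rmorphD /= dbl -normc_real rmorphB /= rmorph1.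
  by rewrite (rmorph_nat (real_complex R) 4).
(* Otherwise [2 z = z (1 - S / z) + (1 - c)], where the right-hand side has size at
   most [|z|]. *)
have Sz0 : S + z - 1 + c%:C != 0.
  apply/eqP => e0.
  have e1 : z *+ 2 = z * (1 - S / z) + (1 - c%:C).
    rewrite mulrBr mulr1 mulrC mulrC [z * (S / z)]mulrC divfK // mulr2n.
    by apply: (eq_of_diff e0); ring.
  have : `|z *+ 2| <= `|z| * 2^-1 + `|z| * 2^-1.
    rewrite e1; apply: le_trans (ler_normD _ _) _; apply: lerD.
      by rewrite normrM ler_wpM2l // distrC.
    rewrite ler_pdivlMr // mulrC; apply: (le_trans _ z_r1').
    by rewrite ler_wpM2l // lerDl.
  rewrite -mulrDr -mulr2n -[2^-1 *+ 2]mulr_natl divff ?pnatr_eq0 // mulr1.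
  by rewrite normrMn mulr2n gerDl lt_geF.
have := psum_h_cvg L_ge0 uL (c := c%:C) (c' := c'%:C)
  (m := fun n => (m n)%:C) (h := fun n => (h n)%:C) (z := z) (S := S)
  erefl erefl complex_planar_momentS complex_linearized_momentS
  (ex_intro _ _ mB) (ex_intro _ _ hB) (ex_intro _ _ dB) z0 erefl S_sqr S_near
  MB z_r1'.
move=> /(geo_nullZ z^-1) null.
rewrite -(linearized_seriesE c'%:C z0 S_sqr S_near abC.1 abC.2 Sz0).
apply: geo_null_cvg; apply: geo_null_ext null => N /=.
rewrite mulrBr; congr (_ - _); rewrite /psum mulr_sumr /series /= big_mkord.
by apply: eq_bigr => n _; rewrite exprVn mulrCA exprS invfM.
Qed.

End ComplexSeries.

(** * Proof of the expansion *)

Lemma cvg_power_bounded0 (R : realType) (x : nat -> R) (l : R) :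
  x @ \oo --> l -> power_bounded 0 x.
Proof.
move=> xl; have /cvg_seq_bounded[B [_ hB]] : cvgn x by apply/cvg_ex; exists l.
exists (B + 1) => N _; rewrite expr0 invr1 mulr1.
by apply: (hB (B + 1)); rewrite ?ltrDl.
Qed.

Theorem mainTheorem3 (R : realType) (c c' : R) (hc : 0 < c)
  (M : nat -> nat) (hM : forall N : nat, (0 < N)%N -> (0 < M N)%N)
  (hlim : (fun N : nat => (M N)%:R / N%:R : R) @ \oo --> c)
  (hlim' : (fun N : nat => (M N)%:R - c * N%:R : R) @ \oo --> c')
  (d : nat -> measure_display) (T : forall N : nat, measurableType (d N))
  (P : forall N : nat, probability (T N) R)
  (G : forall N : nat, 'I_N * 'I_(M N) -> {RV (P N) >-> R})
  (hG : forall N : nat, (0 < N)%N -> iid_standard_normal (G N)) :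
  let m' : nat -> R := infinitesimal_moment G c in
  let a : R := (1 - Num.sqrt c) ^+ 2 in
  let b : R := (1 + Num.sqrt c) ^+ 2 in
  (forall n : nat, (0 < n)%N ->
     moment_correction G c n N @[N --> \oo] --> m' n) /\
  forall sqrtP : R[i]^o -> R[i]^o, is_sqrt_branch a b sqrtP ->
  exists r : R, forall z : R[i], r%:C < `|z| ->
    (series (fun n : nat => (m' n)%:C / z ^+ n.+1) : nat -> R[i]^o) @ \oo -->
    ((- c'%:C / (z * sqrtP z)
       * (((1 - c%:C) ^+ 2 - (1 + c%:C) * z - (1 - c%:C) * sqrtP z)
          / (sqrtP z + z - 1 + c%:C))
     + 2^-1 * (2^-1 * ((z - a%:C)^-1 + (z - b%:C)^-1) - (sqrtP z)^-1))
     : R[i]^o).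
Proof.
move=> m' a b.
pose x N : R := (M N)%:R / N%:R.
have x_rate : (fun N => N%:R * (x N - c)) @ \oo --> c'.
  apply: cvg_trans (near_eq_cvg _) hlim'; near=> N.
  have N0 : N%:R != 0 :> R by rewrite pnatr_eq0 -lt0n; near: N; exists 1%N.
  by rewrite /x; field.
pose E N := mixed_moment (G N).
have cvg_m n : moment_correction G c n N @[N --> \oo] --> linearized_moment c c' n.
  have E_nil N : (0 < N)%N -> E N [::] = 1.
    by move=> N0; apply: mixed_moment_nil => //; exact: hG.
  have E_0 N s : (0 < N)%N -> E N (0%N :: s) = E N s.
    by move=> N0; apply: mixed_moment_0 => //; exact: hG.
  have fact := trace_moments_factorize (cvg_power_bounded0 hlim) E_nil E_0
    (fun N n s N0 => mixed_moment_S N0 (hG N N0) n s).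
  have := moment_expansion_cvg hlim x_rate (n := n) (e := fun N => E N [:: n])
    (power_bounded_ext _ (fact [:: n])).
  have -> : moment_correction G c n =
      (fun N => N%:R * (E N [:: n] - planar_moment c 0 n)).
    apply/funext => N; rewrite /moment_correction sum_noncrossing.
    by congr (_ * (_ - _)); exact: expectation_ntr.
  by apply=> N _; rewrite big_seq1.
have m'E n : m' n = linearized_moment c c' n.
  rewrite /m' /infinitesimal_moment; case: eqP => [->|_] //.
  exact: cvg_lim (cvg_m n).
split=> [n _|sqrtP branch]; first by rewrite m'E.
have [r hr] := linearized_generating_function c' hc branch.
exists r => z /hr; suff -> : linearized_moment c c' = m' by [].
by apply/funext => n; rewrite m'E.
Unshelve. all: by end_near. Qed.
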